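(* Long-term relevance of a Boolean access for a (Boolean) conjunctive query can be decided by a nondeterministic polynomial-time algorithm with access to an oracle for query containment of conjunctive queries under access limitations.
   Context: Model. A schema is a finite set of relations, each with a set of attributes; each attribute $a$ has an abstract domain $\mathrm{Dom}(a)$ taken from a countable set of abstract domains (attributes may share a domain; different domains may overlap). An instance $I$ gives a set $I(S)$ of tuples for each relation $S$. A configuration $\mathrm{Conf}$ is a subset of some instance (relation by relation); it is consistent with $I$ if $\mathrm{Conf}\subseteq I$. An access method consists of a relation $R$ and a set of input attributes among the attributes of $R$ (the others are output attributes); each method is either dependent or independent. A relation may have zero, one or several access methods; with none, its content stays that of the initial configuration. An access is an access method together with a binding $\mathrm{Bind}$ of values to its input attributes; it is Boolean if there are no output attributes. The active domain of $\mathrm{Conf}$ is the set of pairs (constant, abstract domain) such that the constant occurs in $\mathrm{Conf}$ at an attribute with that domain. An access is well-formed at $\mathrm{Conf}$ if its method is independent, or its method is dependent and each bound value, paired with the domain of its input attribute, is in the active domain of $\mathrm{Conf}$. A well-formed access to $R$ with binding $\mathrm{Bind}$ at $\mathrm{Conf}$ on an instance $I\supseteq\mathrm{Conf}$ leads, non-deterministically, to any configuration $\mathrm{Conf}\cup\mathrm{Resp}$ where the response $\mathrm{Resp}$ is any set of tuples of $I(R)$ agreeing with $\mathrm{Bind}$ on the input attributes (accesses are sound but not necessarily exact). A configuration is reachable from $\mathrm{Conf}$ if some sequence of well-formed accesses (on some instance consistent with $\mathrm{Conf}$) can lead from $\mathrm{Conf}$ to it. Queries. Conjunctive queries are existentially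 quantified conjunctions of atoms; queries are Boolean (no free variables). A variable occurring in several attributes requires these to have the same abstract domain, and all constants of a query are assumed to be present in the configuration. A Boolean query is certain at $\mathrm{Conf}$ if it is true in every instance consistent with $\mathrm{Conf}$. Containment. $Q_1$ is contained in $Q_2$ under a set $\mathrm{ACS}$ of access methods starting from $\mathrm{Conf}$ if $Q_1(\mathrm{Conf}')\subseteq Q_2(\mathrm{Conf}')$ for every configuration $\mathrm{Conf}'$ reachable from $\mathrm{Conf}$. The containment problem takes as input the schema, $\mathrm{ACS}$, $\mathrm{Conf}$, $Q_1$ and $Q_2$. Long-term relevance. A path from an access $\alpha_1$ starting from $\mathrm{Conf}$ on $I$ is a sequence $\mathrm{Conf}_1,\alpha_1,\mathrm{Conf}_2,\alpha_2,\dots,\alpha_{n-1},\mathrm{Conf}_n$ with $\mathrm{Conf}_1=\mathrm{Conf}$ and each $\mathrm{Conf}_{i+1}=\mathrm{Conf}_i\cup\mathrm{Resp}_i$ a successor configuration of the well-formed access $\alpha_i$ at $\mathrm{Conf}_i$ on $I$. Its truncated path drops $\alpha_1$ and performs $\alpha_2,\dots,\alpha_i$ with the same responses, $\mathrm{Conf}'_1=\mathrm{Conf}_1$, $\mathrm{Conf}'_j=\mathrm{Conf}'_{j-1}\cup\mathrm{Resp}_j$, where $i$ is maximal such that every $\alpha_j$ ($2\le j\le i$) is well-formed at $\mathrm{Conf}'_{j-1}$. The access $\alpha_1$ is long-term relevant for a Boolean query $Q$ at $\mathrm{Conf}$ if for some instance $I$ consistent with $\mathrm{Conf}$ and some path $p$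 beginning with $\alpha_1$, $Q$ is certain at the final configuration of $p$ but not at the final configuration of its truncated path. The long-term relevance problem takes as input the schema, the access methods, the configuration, the (well-formed) access and the query. *)

(* Defs.v *)
(* MathComp. *)
From HB Require Import structures.
From mathcomp Require Import all_boot.

Set Implicit Arguments.
Unset Strict Implicit.
Unset Printing Implicit Defensive.

(** * Data *)

(* Finite binary trees play the role of the strings of a machine model: they
   are the inputs, the values and the oracle questions of algorithms. *)
Inductive data := Nil | Cons of data & data.

Fixpoint data_eqb (d e : data) : bool :=
  match d, e with
  | Nil, Nil => true
  | Cons d1 d2, Cons e1 e2 => data_eqb d1 e1 && data_eqb d2 e2
  | _, _ => false
  end.

Lemma data_eqP : Equality.axiom data_eqb.
Proof.
elim=> [|d1 IH1 d2 IH2] [|e1 e2] /=; try by constructor.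
apply: (iffP andP) => [[/IH1 -> /IH2 ->] //|[<- <-]].
by split; [apply/IH1|apply/IH2].
Qed.
HB.instance Definition _ := hasDecEq.Build data data_eqP.

Fixpoint dsize (d : data) : nat :=
  if d is Cons d1 d2 then (dsize d1 + dsize d2).+1 else 1.

Definition enc_bool (b : bool) : data := if b then Cons Nil Nil else Nil.

Definition enc_seq (T : Type) (enc : T -> data) (s : seq T) : data :=
  foldr (fun x d => Cons (enc x) d) Nil s.

(** * Nondeterministic oracle algorithms *)

(* The WHILE language of N. D. Jones, extended with a nondeterministic choice
   and an oracle call. *)
Inductive expr :=
  | Var of nat
  | ENil
  | ECons of expr & expr
  | EHd of expr
  | ETl of expr
  | EEq of expr & expr.

Inductive cmd :=
  | Skip
  | Assign of nat & expr
  | Seq of cmd & cmd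
  | If of expr & cmd & cmd
  | While of expr & cmd
  | Choose of nat
  | Ask of nat & expr.

Definition store := nat -> data.

Definition upd (s : store) (x : nat) (d : data) : store :=
  fun y => if y == x then d else s y.

Fixpoint eval (s : store) (e : expr) : data :=
  match e with
  | Var x => s x
  | ENil => Nil
  | ECons e1 e2 => Cons (eval s e1) (eval s e2)
  | EHd e1 => if eval s e1 is Cons d _ then d else Nil
  | ETl e1 => if eval s e1 is Cons _ d then d else Nil
  | EEq e1 e2 => enc_bool (eval s e1 == eval s e2)
  end.

(* Every operation is charged the size of its result.  Hence no value, and in
   particular no question put to the oracle, is larger than the time spent on
   it (plus the input), and time agrees with that of oracle Turing machines up
   to a polynomial.  With unit costs this would fail: n assignments
   X := cons X X build a tree of size 2^n. *)
Fixpoint ecost (s : store) (e : expr) : nat :=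
  dsize (eval s e) +
  match e with
  | ECons e1 e2 | EEq e1 e2 => ecost s e1 + ecost s e2
  | EHd e1 | ETl e1 => ecost s e1
  | _ => 0
  end.

(* The second component lists the outcomes of the nondeterministic choices
   still to be made; a computation is determined by its initial state. *)
Definition state := (store * (nat -> bool))%type.

(* [run O c st t st']: with oracle [O], started in [st], the command [c] halts
   in [st'] after time [t]. *)
Inductive run (O : data -> Prop) : cmd -> state -> nat -> state -> Prop :=
  | RunSkip st : run O Skip st 1 st
  | RunAssign s w x e :
      run O (Assign x e) (s, w) (ecost s e).+1 (upd s x (eval s e), w)
  | RunSeq c1 c2 st t1 st1 t2 st2 :
      run O c1 st t1 st1 -> run O c2 st1 t2 st2 ->
      run O (Seq c1 c2) st (t1 + t2).+1 st2
  | RunIfTrue e c1 c2 s w t st' :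
      eval s e != Nil -> run O c1 (s, w) t st' ->
      run O (If e c1 c2) (s, w) (ecost s e + t).+1 st'
  | RunIfFalse e c1 c2 s w t st' :
      eval s e = Nil -> run O c2 (s, w) t st' ->
      run O (If e c1 c2) (s, w) (ecost s e + t).+1 st'
  | RunWhileTrue e c s w t1 st1 t2 st2 :
      eval s e != Nil -> run O c (s, w) t1 st1 ->
      run O (While e c) st1 t2 st2 ->
      run O (While e c) (s, w) (ecost s e + t1 + t2).+1 st2
  | RunWhileFalse e c s w :
      eval s e = Nil -> run O (While e c) (s, w) (ecost s e).+1 (s, w)
  | RunChoose s w x :
      run O (Choose x) (s, w) 1
        (upd s x (enc_bool (w 0)), fun n => w n.+1)
  | RunAskYes s w x e :
      O (eval s e) ->
      run O (Ask x e) (s, w) (ecost s e).+1 (upd s x (enc_bool true), w)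
  | RunAskNo s w x e :
      ~ O (eval s e) ->
      run O (Ask x e) (s, w) (ecost s e).+1 (upd s x (enc_bool false), w).

(* Variable 0 holds the input at the start and the verdict at the end. *)
Definition init (d : data) : store := upd (fun=> Nil) 0 d.

Definition accepting (st : state) : Prop := st.1 0 != Nil.

(* The language [L] is in NP with oracle [O]: all computations of some algorithm
   halt in time polynomial in the size of the input, and the inputs with
   an accepting computation are exactly those in [L]. *)
Definition NP_with_oracle (O L : data -> Prop) : Prop :=
  exists (c : cmd) (k : nat), forall d : data,
    (forall w, exists t st,
        run O c (init d, w) t st /\ t <= k * dsize d ^ k + k) /\
    (L d <-> exists w t st, run O c (init d, w) t st /\ accepting st).

(** * Schemas, configurations, access methods *)

(* Names of relations and of abstract domains, constants and query variables
   are all drawn from one countably infinite set, that of data, so that they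
   are encoded by themselves.  Abstract domains are used only as labels: the
   same constant may occur under any of them. *)
Definition name := data.

(* A relation is given with the abstract domains of its attributes, which are
   identified with their positions. *)
Definition schema := seq (name * seq name).

Definition tuple_set := seq name -> Prop.

(* Instances and configurations. *)
Definition database := name -> tuple_set.

Definition over (sch : schema) (I : database) : Prop :=
  forall S t, I S t ->
    exists2 doms, (S, doms) \in sch & size t = size doms.

Definition consistent (C I : database) : Prop :=
  forall S t, C S t -> I S t.

Definition of_facts (F : seq (name * seq name)) : database :=
  fun S t => (S, t) \in F.

Definition active_domain (sch : schema) (C : database) (v D : name) : Prop :=
  exists S doms t,
    [/\ (S, doms) \in sch, C S t & (v, D) \in zip t doms].

(* [inputs] tells for each attribute of the relation whether it is an input
   attribute. *)
Record method := Method { rel : name; inputs : seq bool; dependent : bool }.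

Definition method_rep (m : method) := (rel m, inputs m, dependent m).
Definition method_abs (p : name * seq bool * bool) := Method p.1.1 p.1.2 p.2.
Lemma method_repK : cancel method_rep method_abs.
Proof. by case. Qed.
HB.instance Definition _ := Equality.copy method (can_type method_repK).

(* [binding] lists the values of the input attributes in order. *)
Record access := Access { meth : method; binding : seq name }.

Definition boolean_access (a : access) : bool := all id (inputs (meth a)).

(* The access is syntactically one allowed by the access methods [acs]. *)
Definition access_of (acs : seq method) (a : access) : Prop :=
  meth a \in acs /\ size (binding a) = count id (inputs (meth a)).

Definition well_formed (sch : schema) (C : database) (a : access) : Prop :=
  dependent (meth a) ->
  forall doms v D, (rel (meth a), doms) \in sch ->
    (v, D) \in zip (binding a) (mask (inputs (meth a)) doms) ->
    active_domain sch C v D.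

Definition response (I : database) (a : access) (r : tuple_set) : Prop :=
  forall t, r t ->
    I (rel (meth a)) t /\ mask (inputs (meth a)) t = binding a.

(** * Paths *)

Definition extend (C : database) (ar : access * tuple_set) : database :=
  fun S t => C S t \/ (S = rel (meth ar.1) /\ ar.2 t).

Definition final (C : database) (p : seq (access * tuple_set)) : database :=
  foldl extend C p.

Fixpoint all_well_formed (sch : schema) (C : database)
    (p : seq (access * tuple_set)) : Prop :=
  if p is ar :: p' then
    well_formed sch C ar.1 /\ all_well_formed sch (extend C ar) p'
  else True.

Fixpoint all_sound (acs : seq method) (I : database)
    (p : seq (access * tuple_set)) : Prop :=
  if p is ar :: p' then
    [/\ access_of acs ar.1, response I ar.1 ar.2 & all_sound acs I p']
  else True.

Definition path_on (sch : schema) (acs : seq method) (I C : database)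
    (p : seq (access * tuple_set)) : Prop :=
  all_sound acs I p /\ all_well_formed sch C p.

Definition reachable (sch : schema) (acs : seq method) (C C' : database) :=
  exists I p, [/\ over sch I, consistent C I, path_on sch acs I C p
                & C' = final C p].

(** * Boolean conjunctive queries *)

Inductive term := TVar of name | TConst of name.

Definition term_rep (t : term) : name + name :=
  match t with TVar x => inl x | TConst c => inr c end.
Definition term_abs (u : name + name) : term :=
  match u with inl x => TVar x | inr c => TConst c end.
Lemma term_repK : cancel term_rep term_abs.
Proof. by case. Qed.
HB.instance Definition _ := Equality.copy term (can_type term_repK).

(* A conjunction of atoms, all of whose variables are existentially
   quantified. *)
Definition query := seq (name * seq term).

Definition subst (nu : name -> name) (t : term) : name :=
  match t with TVar x => nu x | TConst c => c end.

Definition holds (Q : query) (I : database) : Prop :=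
  exists nu : name -> name,
    forall S ts, (S, ts) \in Q -> I S (map (subst nu) ts).

Definition certain (sch : schema) (C : database) (Q : query) : Prop :=
  forall I, over sch I -> consistent C I -> holds Q I.

(** * Containment and long-term relevance *)

Definition contained (sch : schema) (acs : seq method) (C : database)
    (Q1 Q2 : query) : Prop :=
  forall C', reachable sch acs C C' -> holds Q1 C' -> holds Q2 C'.

(* The longest prefix of [p] that is well-formed from [C] has length [i]. *)
Definition truncated_at (sch : schema) (C : database)
    (p : seq (access * tuple_set)) (i : nat) : Prop :=
  [/\ i <= size p, all_well_formed sch C (take i p)
    & forall j, j <= size p -> all_well_formed sch C (take j p) -> j <= i].

Definition long_term_relevant (sch : schema) (acs : seq method)
    (C : database) (a : access) (Q : query) : Prop :=
  exists I r p i,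
    [/\ over sch I, consistent C I & path_on sch acs I C ((a, r) :: p)] /\
    [/\ truncated_at sch C p i, certain sch (final C ((a, r) :: p)) Q
      & ~ certain sch (final C (take i p)) Q].

(** * The two decision problems *)

Definition valid_schema (sch : schema) : Prop := uniq (unzip1 sch).

Definition valid_methods (sch : schema) (acs : seq method) : Prop :=
  forall m, m \in acs ->
    exists2 doms, (rel m, doms) \in sch & size (inputs m) = size doms.

(* The variables have a typing by abstract domains, and the constants occur in
   the configuration. *)
Definition valid_query (sch : schema) (conf : seq (name * seq name))
    (Q : query) : Prop :=
  [/\ forall S ts, (S, ts) \in Q ->
        exists2 doms, (S, doms) \in sch & size ts = size doms,
      exists tau : name -> name,
        forall S ts doms x D, (S, ts) \in Q -> (S, doms) \in sch ->
          (TVar x, D) \in zip ts doms -> tau x = D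
    & forall S ts c, (S, ts) \in Q -> TConst c \in ts ->
        exists S' t, (S', t) \in conf /\ c \in t].

Definition enc_named (T : Type) (enc : T -> data) (p : name * T) : data :=
  Cons p.1 (enc p.2).

Definition enc_names : seq name -> data := enc_seq (fun v : name => v).

Definition enc_schema : schema -> data := enc_seq (enc_named enc_names).

Definition enc_conf : seq (name * seq name) -> data :=
  enc_seq (enc_named enc_names).

Definition enc_method (m : method) : data :=
  Cons (rel m) (Cons (enc_seq enc_bool (inputs m)) (enc_bool (dependent m))).

Definition enc_access (a : access) : data :=
  Cons (enc_method (meth a)) (enc_names (binding a)).

Definition enc_term (t : term) : data :=
  match t with
  | TVar x => Cons (enc_bool false) x
  | TConst c => Cons (enc_bool true) c
  end.

Definition enc_query : query -> data :=
  enc_seq (enc_named (enc_seq enc_term)).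

(* Strings that do not encode a legal input are not in the language; likewise
   below. *)
Definition containment_language (d : data) : Prop :=
  exists sch acs conf Q1 Q2,
    [/\ d = Cons (enc_schema sch) (Cons (enc_seq enc_method acs)
              (Cons (enc_conf conf) (Cons (enc_query Q1) (enc_query Q2)))),
        [/\ valid_schema sch, valid_methods sch acs,
            over sch (of_facts conf), valid_query sch conf Q1
          & valid_query sch conf Q2]
      & contained sch acs (of_facts conf) Q1 Q2].

Definition boolean_ltr_language (d : data) : Prop :=
  exists sch acs conf a Q,
    [/\ d = Cons (enc_schema sch) (Cons (enc_seq enc_method acs)
              (Cons (enc_conf conf) (Cons (enc_access a) (enc_query Q)))),
        [/\ valid_schema sch, valid_methods sch acs,
            over sch (of_facts conf) & valid_query sch conf Q],
        [/\ access_of acs a, boolean_access a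
          & well_formed sch (of_facts conf) a]
      & long_term_relevant sch acs (of_facts conf) a Q].

(* Main.v *)
(* Write C for the configuration, R(B) for the fact that the Boolean access may return,
   and C+ for C with R(B).  Let p be a path that witnesses relevance.  Either its facts,
   with C but without R(B), do not make Q true; or p is truncated, because some dependent
   method m is called with a value of B at a domain where it is not known without R(B),
   after a path whose facts with C do not make Q true.  Conversely, in the first situation
   it is enough that p is well-formed from C+, since truncation only loses facts.  In the
   second, it suffices that Q can become true from C+ and that some path from C+, whose
   facts with C do not make Q true, makes all input domains of m nonempty: if that path is
   well-formed from C, the constants that C does not have are renamed along it, so that
   the call of m with the value of B is still impossible without R(B).

   Both situations are non-containments.  A fresh relation N holding B, with the domains
   of R, provides the values of B but not the fact R(B).  In the first situation Q, with
   the atoms mapped to R(B) renamed to N, is not contained in Q.  In the second, a copy W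
   of the relation of m with the method m is added, and the query W is not contained in
   Q.  The remaining conditions on the input are put to the oracle as well: legality of
   the input as the containment of Q in itself, and membership in the active domain as the
   reachability of a fresh relation by a dependent access. *)

From Stdlib Require Import Classical ClassicalEpsilon FunctionalExtensionality.
From mathcomp Require Import all_boot zify.
Require Import Defs.

Set Implicit Arguments.
Unset Strict Implicit.
Unset Printing Implicit Defensive.

(** * Paths *)

(** The facts returned along a path, apart from the configuration it starts from. The same path is
    compared from two starting points below, and this is the part they share. *)
Definition gain (p : seq (access * tuple_set)) : database :=
  final (fun _ _ => False) p.

Lemma finalE C p S t : final C p S t <-> C S t \/ gain p S t.
Proof.
rewrite /gain; elim: p C => [|ar p IHp] C /=; first by tauto.
by rewrite IHp (IHp (extend _ _)) /extend; tauto.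
Qed.

Lemma gain_cons ar p S t :
  gain (ar :: p) S t <-> (S = rel (meth ar.1) /\ ar.2 t) \/ gain p S t.
Proof. by rewrite /gain /= finalE /extend /gain; tauto. Qed.

Lemma gain_cat p1 p2 S t :
  gain (p1 ++ p2) S t <-> gain p1 S t \/ gain p2 S t.
Proof. by rewrite {1}/gain /final foldl_cat; exact: finalE. Qed.

Lemma final_mono C C' p1 p2 : consistent C C' -> consistent (gain p1) (gain p2) ->
  consistent (final C p1) (final C' p2).
Proof. by move=> CC' pp S t; rewrite !finalE => -[/CC'|/pp]; tauto. Qed.

Lemma consistent_final C p : consistent C (final C p).
Proof. by move=> S t CSt; rewrite finalE; left. Qed.

Lemma consistent_take p i : consistent (gain (take i p)) (gain p).
Proof. by move=> S t; rewrite -{2}(cat_take_drop i p) gain_cat; left. Qed.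

Lemma consistent_of_facts_cons f F : consistent (of_facts F) (of_facts (f :: F)).
Proof. by move=> S t; rewrite /of_facts inE => ->; rewrite orbT. Qed.

Lemma holds_mono Q C C' : consistent C C' -> holds Q C -> holds Q C'.
Proof. by move=> CC' [nu nuP]; exists nu => S ts /nuP /CC'. Qed.

(** [C] is itself an instance consistent with [C], and conjunctive queries are monotone. *)
Lemma certainE sch C Q : over sch C -> certain sch C Q <-> holds Q C.
Proof.
move=> oC; split=> [|hQ I _ CI]; first by apply.
exact: holds_mono CI hQ.
Qed.

(** The largest instance over the schema. As responses need only be sound, a path on any instance is
    also a path on this one. *)
Definition full (sch : schema) : database :=
  fun S t => exists2 doms, (S, doms) \in sch & size t = size doms.

Lemma over_full sch : over sch (full sch). Proof. by move=> S t. Qed.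

Lemma active_domain_mono sch C C' v D :
  consistent C C' -> active_domain sch C v D -> active_domain sch C' v D.
Proof.
by move=> CC' [S [doms [t [Ss /CC' Ct vD]]]]; exists S, doms, t.
Qed.

Lemma active_domain_final sch C p v D :
  active_domain sch (final C p) v D <->
  active_domain sch C v D \/ active_domain sch (gain p) v D.
Proof.
split=> [[S [doms [t [Ss]]]]|[]].
- by rewrite finalE => -[Ct|Ct] vD; [left|right]; exists S, doms, t.
- exact/active_domain_mono/consistent_final.
by apply/active_domain_mono => S t; rewrite finalE; right.
Qed.

Lemma schema_fun (sch : schema) S doms doms' : valid_schema sch ->
  (S, doms) \in sch -> (S, doms') \in sch -> doms = doms'.
Proof.
rewrite /valid_schema; elim: sch => //= -[S1 d1] sch IH /= /andP[S1N us].
rewrite !inE => /orP[/eqP[-> ->]|Ss] /orP[/eqP[]|Ss'] //.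
- by have := map_f fst Ss'; rewrite /= (negbTE S1N).
- by move=> eS _; have := map_f fst Ss; rewrite /= eS (negbTE S1N).
exact: IH.
Qed.

Lemma active_domain_cons sch S0 t0 doms0 C v D : valid_schema sch ->
  (S0, doms0) \in sch ->
  active_domain sch (of_facts ((S0, t0) :: C)) v D <->
  (v, D) \in zip t0 doms0 \/ active_domain sch (of_facts C) v D.
Proof.
move=> us s0; split=> [[S [doms [t [Ss]]]]|[vD|]].
- rewrite /of_facts inE => /orP[/eqP[eS et]|Ct] vD; last first.
    by right; exists S, doms, t.
  left; suff <- : doms = doms0 by rewrite -et.
  move: Ss; rewrite eS => Ss; exact: schema_fun us Ss s0.
- by exists S0, doms0, t0; rewrite /of_facts inE eqxx.
exact/active_domain_mono/consistent_of_facts_cons.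
Qed.

Lemma well_formed_transfer sch1 sch2 C1 C2 a :
  (forall doms, (rel (meth a), doms) \in sch2 -> (rel (meth a), doms) \in sch1) ->
  (forall v D, active_domain sch1 C1 v D -> active_domain sch2 C2 v D) ->
  well_formed sch1 C1 a -> well_formed sch2 C2 a.
Proof. by move=> s21 ad wf dep doms v D /s21 s1 vD; apply/ad/wf/vD. Qed.

Lemma well_formed_mono sch C C' a :
  consistent C C' -> well_formed sch C a -> well_formed sch C' a.
Proof.
by move=> CC'; apply: well_formed_transfer => // v D; apply: active_domain_mono.
Qed.

(** Well-formedness sees a schema only through the domains of the accessed relations and through the
    active domain. This carries paths between a schema and its extension. *)
Lemma all_well_formed_transfer sch1 sch2 acs I p C1 C2 :
  (forall m doms, m \in acs ->
     ((rel m, doms) \in sch1) = ((rel m, doms) \in sch2)) ->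
  (forall v D, active_domain sch1 C1 v D -> active_domain sch2 C2 v D) ->
  all_sound acs I p -> all_well_formed sch1 C1 p -> all_well_formed sch2 C2 p.
Proof.
move=> s12; elim: p C1 C2 => //= -[a r] p IHp C1 C2 ad.
move=> [[ma sa] ra sp] [wa wp]; split.
  by apply: well_formed_transfer ad wa => doms; rewrite /= s12.
apply: IHp wp => // v D [S [doms [t [Ss [C1t|[eS rt]] vD]]]].
  have [S' [doms' [t' [S's C2t vD']]]] : active_domain sch2 C2 v D.
    by apply: ad; exists S, doms, t.
  by exists S', doms', t'; split=> //; left.
exists S, doms, t; split=> //; last by right.
by move: Ss; rewrite eS /= s12.
Qed.

Lemma all_well_formed_mono sch C C' p : consistent C C' ->
  all_well_formed sch C p -> all_well_formed sch C' p.
Proof.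
elim: p C C' => //= ar p IHp C C' CC' [wa wp].
split; first exact: well_formed_mono wa.
by apply: IHp wp => S t [/CC'|]; [left|right].
Qed.

Lemma all_well_formed_cat sch C p1 p2 :
  all_well_formed sch C (p1 ++ p2) <->
  all_well_formed sch C p1 /\ all_well_formed sch (final C p1) p2.
Proof.
elim: p1 C => [|ar p1 IHp] C /=; first tauto.
by rewrite IHp; tauto.
Qed.

Lemma all_sound_cat acs I p1 p2 :
  all_sound acs I (p1 ++ p2) <-> all_sound acs I p1 /\ all_sound acs I p2.
Proof.
elim: p1 => [|ar p1 IHp] /=; first tauto.
by split=> [[? ? /IHp[]]|[[? ? ?] ?]] //; split=> //; apply/IHp.
Qed.

Lemma all_sound_transfer acs I I' p :
  (forall m t, m \in acs -> I (rel m) t -> I' (rel m) t) ->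
  all_sound acs I p -> all_sound acs I' p.
Proof.
move=> II'; elim: p => //= -[a r] p IHp [[ma sa] ra /IHp sp]; split=> //.
by move=> t /ra[It et]; split=> //; apply: II'.
Qed.

Lemma all_sound_incl acs acs' I p : {subset acs <= acs'} ->
  all_sound acs I p -> all_sound acs' I p.
Proof.
move=> sub; elim: p => //= ar p IHp [[ma sa] ra /IHp sp].
by split=> //; split=> //; apply: sub.
Qed.

Lemma gain_sound acs I p S t : all_sound acs I p -> gain p S t ->
  I S t /\ exists2 m, m \in acs & S = rel m.
Proof.
elim: p => [//|[a r] p IHp] /= [[ma _] ra /IHp sp] /gain_cons[[/= -> /ra[It _]]|//].
by split=> //; exists (meth a).
Qed.

Lemma over_final sch acs C p : over sch C -> all_sound acs (full sch) p ->
  over sch (final C p).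
Proof. by move=> oC sp S t /finalE[/oC //|/(gain_sound sp)[]]. Qed.

Lemma all_sound_full sch acs I p : over sch I -> all_sound acs I p ->
  all_sound acs (full sch) p.
Proof. by move=> oI; apply: all_sound_transfer => m t _ /oI. Qed.

Lemma truncated_ex sch C p : exists i, truncated_at sch C p i.
Proof.
elim: p C => [|ar p IHp] C.
  by exists 0; split=> // j; rewrite leqn0 => /eqP->.
have [wa|nwa] := classic (well_formed sch C ar.1).
  have [i [ip wi maxi]] := IHp (extend C ar).
  by exists i.+1; split=> // -[|j] //= jp [_ /maxi]; apply.
by exists 0; split=> // -[|j] //= jp [].
Qed.

Lemma reachableE sch acs C C' : over sch C ->
  reachable sch acs C C' <->
  exists2 p, path_on sch acs (full sch) C p & C' = final C p.
Proof.
move=> oC; split=> [[I [p [oI CI [sp wp] ->]]]|[p pp ->]].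
  by exists p => //; split=> //; apply: all_sound_full sp.
by exists (full sch), p; split=> //; exact: over_full.
Qed.

(** * Renaming constants along a path *)

Lemma dsize_gt0 d : 0 < dsize d. Proof. by case: d. Qed.

Lemma dsize_enc_seq (T : eqType) (enc : T -> data) (s : seq T) x :
  x \in s -> dsize (enc x) < dsize (enc_seq enc s).
Proof.
elim: s => //= y s IHs; rewrite inE => /orP[/eqP->|/IHs]; lia.
Qed.

Lemma dsize_enc_named S t F : (S, t) \in F ->
  dsize S < dsize (enc_conf F) /\ forall v, v \in t -> dsize v < dsize (enc_conf F).
Proof.
move=> Ft; have := dsize_enc_seq (enc_named enc_names) Ft.
rewrite -/(enc_conf F) /= => szt; split=> [|v vt]; first by lia.
have := dsize_enc_seq (fun v : name => v) vt; rewrite -/(enc_names t); lia.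
Qed.

Lemma mask_zip (S T : Type) m (s : seq S) (t : seq T) :
  mask m (zip s t) = zip (mask m s) (mask m t).
Proof.
elim: m s t => [|[] m IHm] [|x s] [|y t] //=; rewrite ?IHm //.
all: by case: (mask m _).
Qed.

Lemma mem_zip_l (S T : eqType) (s : seq S) (t : seq T) x y :
  (x, y) \in zip s t -> x \in s.
Proof.
elim: s t => [|x' s IHs] [|y' t] //=; rewrite !inE => /orP[/eqP[-> _]|/IHs->].
  by rewrite eqxx.
by rewrite orbT.
Qed.

Lemma mem_zip_r (S T : eqType) (s : seq S) (t : seq T) x y :
  (x, y) \in zip s t -> y \in t.
Proof.
elim: s t => [|x' s IHs] [|y' t] //=; rewrite !inE => /orP[/eqP[_ ->]|/IHs->].
  by rewrite eqxx.
by rewrite orbT.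
Qed.

Lemma mem_zip_exists (S T : eqType) (s : seq S) (t : seq T) y :
  size s = size t -> y \in t -> exists x, (x, y) \in zip s t.
Proof.
elim: s t => [|x s IHs] [|y' t] //= [st]; rewrite inE => /orP[/eqP->|].
  by exists x; rewrite inE eqxx.
by case/(IHs _ st) => x' xy; exists x'; rewrite inE xy orbT.
Qed.

Lemma mem_zip_map (S T : eqType) (f : T -> S) (t : seq T) x y :
  (x, y) \in zip (map f t) t -> x = f y.
Proof.
by elim: t => //= z t IHt; rewrite inE => /orP[/eqP[-> ->]|/IHt].
Qed.

Lemma mask_all_true (T : Type) m (s : seq T) :
  all id m -> size s = size m -> mask m s = s.
Proof. by elim: m s => [|[] m IHm] [|x s] //= am [sm]; rewrite IHm. Qed.

Lemma method_domains sch acs m : valid_methods sch acs -> valid_schema sch ->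
  m \in acs -> forall doms, (rel m, doms) \in sch -> size (inputs m) = size doms.
Proof.
by move=> va us /va[doms' s' ->] doms s; rewrite (schema_fun us s s').
Qed.

(* A constant is moved out of the way under those abstract domains under which
   the database [C] does not hold it; [Z] marks the constants so moved. *)
Section Renaming.
Variables (sch : schema) (acs : seq method) (conf : seq (name * seq name)) (Z : data).
Hypothesis us : valid_schema sch.
Hypothesis va : valid_methods sch acs.
Hypothesis Zlarge : dsize (enc_conf conf) <= dsize Z.
Let C := of_facts conf.

Definition rename (D v : name) : name :=
  if excluded_middle_informative (active_domain sch C v D) then v else Cons Z v.

(** One inverse for all domains, so that a valuation is mapped back by composing with it. *)
Definition unrename (v : name) : name :=
  if v is Cons z u then if z == Z then u else v else v.

Definition rename_tuple (doms t : seq name) : seq name :=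
  [seq rename vD.2 vD.1 | vD <- zip t doms].

Definition domains_of (S : name) : seq name :=
  nth [::] (unzip2 sch) (index S (unzip1 sch)).

Definition rename_step (ar : access * tuple_set) : access * tuple_set :=
  let: (a, r) := ar in
  let doms := domains_of (rel (meth a)) in
  (Access (meth a) (rename_tuple (mask (inputs (meth a)) doms) (binding a)),
   fun t' => exists2 t, r t & t' = rename_tuple doms t).

Lemma domains_ofP S doms : (S, doms) \in sch -> domains_of S = doms.
Proof.
move=> Ss; apply: (schema_fun us _ Ss).
have : S \in unzip1 sch by apply: (map_f fst Ss).
rewrite /domains_of; elim: (sch) => //= -[S1 d1] s IHs; rewrite !inE eq_sym.
case: (eqVneq S1 S) => [->|_ /= sS]; first by rewrite eqxx.
by rewrite (IHs sS) orbT.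
Qed.

(** A moved constant contains [Z] and is therefore larger than [Z]. *)
Lemma unrename_small v : dsize v <= dsize Z -> unrename v = v.
Proof. by case: v => //= z u; case: eqP => // ->; lia. Qed.

Lemma active_domain_small v D : active_domain sch C v D -> dsize v < dsize Z.
Proof.
move=> [S [doms [t [_ Ct /mem_zip_l vt]]]].
by have [_ /(_ v vt)] := dsize_enc_named Ct; lia.
Qed.

Lemma rename_active v D : active_domain sch C v D -> rename D v = v.
Proof. by rewrite /rename; case: excluded_middle_informative. Qed.

Lemma renameK v D : unrename (rename D v) = v.
Proof.
rewrite /rename; case: excluded_middle_informative => [aD|_] /=.
  by apply/unrename_small/ltnW/(active_domain_small aD).
by rewrite eqxx.
Qed.

Lemma rename_tupleK doms t :
  size t = size doms -> map unrename (rename_tuple doms t) = t.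
Proof.
rewrite /rename_tuple.
by elim: doms t => [|D doms IH] [|v t] //= [st]; rewrite renameK IH.
Qed.

Lemma zip_rename_tuple doms t :
  zip (rename_tuple doms t) doms =
  [seq (rename vD.2 vD.1, vD.2) | vD <- zip t doms].
Proof.
rewrite /rename_tuple.
by elim: doms t => [|D doms IH] [|v t] //=; rewrite IH.
Qed.

Lemma mem_rename_tuple doms t v D : (v, D) \in zip t doms ->
  (rename D v, D) \in zip (rename_tuple doms t) doms.
Proof. by rewrite zip_rename_tuple => vD; apply/mapP; exists (v, D). Qed.

Lemma mem_rename_tupleE doms t v' D : (v', D) \in zip (rename_tuple doms t) doms ->
  exists2 v, v' = rename D v & (v, D) \in zip t doms.
Proof. by rewrite zip_rename_tuple => /mapP[[v E] vE [-> ->]]; exists v. Qed.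

Lemma gain_rename p S t' : gain (map rename_step p) S t' <->
  exists2 t, gain p S t & t' = rename_tuple (domains_of S) t.
Proof.
elim: p => [|[a r] p IHp] /=; first by split=> [[]|[? []]].
rewrite gain_cons IHp /=; split.
  move=> [[-> [t rt ->]]|[t pt ->]]; exists t => //; apply/gain_cons; last by right.
  by left.
move=> [t /gain_cons[/= [-> rt] ->|pt ->]]; last by right; exists t.
by left; split=> //; exists t.
Qed.

Lemma active_domain_rename p v D : active_domain sch (gain p) v D ->
  active_domain sch (gain (map rename_step p)) (rename D v) D.
Proof.
move=> [S [doms [t [Ss pt vD]]]].
exists S, doms, (rename_tuple doms t); split=> //; last exact: mem_rename_tuple.
by apply/gain_rename; exists t => //; rewrite (domains_ofP Ss).
Qed.

Lemma size_rename_tuple doms t : size t = size doms ->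
  size (rename_tuple doms t) = size doms.
Proof. by move=> st; rewrite size_map size_zip st minnn. Qed.

Lemma all_sound_rename p : all_sound acs (full sch) p ->
  all_sound acs (full sch) (map rename_step p).
Proof.
elim: p => //= -[a r] p IHp [[/= ma sa] ra /IHp sp]; split=> //=.
  split=> //=; have [doms Ss sm] := va ma.
  by rewrite size_rename_tuple ?(domains_ofP Ss) size_mask.
move=> _ [t rt ->]; have [/= [doms Ss st] <-] := ra _ rt.
rewrite (domains_ofP Ss); split; first by exists doms; rewrite ?size_rename_tuple.
by rewrite /rename_tuple -map_mask mask_zip.
Qed.

(** Well-formedness speaks of pairs of a value and a domain, and the renaming treats such a pair in
    the same way wherever it occurs. *)
Lemma all_well_formed_rename p C1 C2 : all_sound acs (full sch) p ->
  (forall v D, active_domain sch C1 v D -> active_domain sch C2 (rename D v) D) ->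
  all_well_formed sch C1 p -> all_well_formed sch C2 (map rename_step p).
Proof.
elim: p C1 C2 => //= -[a r] p IHp C1 C2 [[/= ma sa] ra sp] C12 [wa wp]; split.
  move=> dep doms v' D /= Ss; rewrite (domains_ofP Ss) => vD.
  by have [v -> /(wa dep _ _ _ Ss)/C12] := mem_rename_tupleE vD.
apply: IHp wp => // v D [S [doms [t [Ss [C1t|[/= eS rt]] vD]]]].
  apply: (@active_domain_mono _ C2); first by left.
  by apply: C12; exists S, doms, t.
exists S, doms, (rename_tuple doms t); split=> //; last exact: mem_rename_tuple.
by right; split=> //=; exists t => //; rewrite -eS (domains_ofP Ss).
Qed.

(** A valuation into the renamed facts is composed with [unrename]. The constants of the query and
    the facts of the configuration are no larger than [Z], hence left alone. *)
Lemma holds_rename (Q : query) p : all_sound acs (full sch) p ->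
  (forall S ts c, (S, ts) \in Q -> TConst c \in ts ->
     exists S' t, (S', t) \in conf /\ c \in t) ->
  holds Q (final C (map rename_step p)) -> holds Q (final C p).
Proof.
move=> sp Qc [nu nuP]; exists (unrename \o nu) => S ts Sts.
have smallC S' t v : (S', t) \in conf -> v \in t -> dsize v <= dsize Z.
  by move=> /dsize_enc_named[_ vt] /vt; lia.
have -> : map (subst (unrename \o nu)) ts = map unrename (map (subst nu) ts).
  rewrite -map_comp; apply/eq_in_map => -[x|c] //= /(Qc _ _ _ Sts)[S' [t [tF ct]]].
  by rewrite unrename_small // (smallC _ _ _ tF).
have /finalE[Ct|/gain_rename[t pt ->]] := nuP _ _ Sts; apply/finalE.
  left; rewrite (_ : map _ _ = map (subst nu) ts) //.
  by apply/map_id_in => v /(smallC _ _ _ Ct)/unrename_small.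
right; have [[doms Ss st] _] := gain_sound sp pt.
by rewrite (domains_ofP Ss) rename_tupleK.
Qed.

(** A moved constant is larger than [Z] and so differs from [b], while an unmoved one was already
    known at its domain. Hence no renamed response reveals [b] at [D]. *)
Lemma active_domain_renamed p b D : dsize b <= dsize Z ->
  ~ active_domain sch C b D ->
  ~ active_domain sch (final C (map rename_step p)) b D.
Proof.
move=> bZ nb /active_domain_final[//|[S [doms [t [Ss /gain_rename[u _ ->]]]]]].
rewrite (domains_ofP Ss) => /mem_rename_tupleE[v eb _].
have [aD|naD] := classic (active_domain sch C v D).
  by apply: nb; rewrite eb (rename_active aD).
by move: bZ; rewrite eb /rename; case: excluded_middle_informative => //= _; lia.
Qed.

End Renaming.

(** * A characterization of long-term relevance *)

Section Characterization.
Variables (sch : schema) (acs : seq method) (conf : seq (name * seq name)).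
Variables (a : access) (Q : query) (doms : seq name).
Hypothesis us : valid_schema sch.
Hypothesis va : valid_methods sch acs.
Hypothesis oC : over sch (of_facts conf).
Hypothesis aa : access_of acs a.
Hypothesis ba : boolean_access a.
Hypothesis wa : well_formed sch (of_facts conf) a.
Hypothesis Rdoms : (rel (meth a), doms) \in sch.
Let R := rel (meth a).
Let B := binding a.
Let C := of_facts conf.
Let C1 := of_facts ((R, B) :: conf).

(* The paths of the definition of relevance may be taken on the instance [full sch],
   as responses need not be exact. *)
Definition useful_by_path : Prop :=
  exists p, [/\ path_on sch acs (full sch) C1 p, holds Q (final C1 p)
              & ~ holds Q (final C p)].

(** A call of [m] with [b] at [D] is what the truncated path may be unable to make, since the
    configuration does not provide [b] there. *)
Definition unlockable (m : method) (D : name) : Prop :=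
  [/\ m \in acs, dependent m,
      exists2 mdoms, (rel m, mdoms) \in sch & D \in mask (inputs m) mdoms
    & exists2 b, (b, D) \in zip B doms & ~ active_domain sch C b D].

(** The inputs can be bound separately, so one known value in every input domain is enough; which
    values a call uses is left open. *)
Definition callable_with (m : method) (C0 : database) : Prop :=
  forall mdoms E, (rel m, mdoms) \in sch -> E \in mask (inputs m) mdoms ->
  exists v, active_domain sch C0 v E.

Definition useful_by_truncation : Prop :=
  (exists2 p, path_on sch acs (full sch) C1 p & holds Q (final C1 p)) /\
  exists m D p, [/\ unlockable m D, path_on sch acs (full sch) C1 p,
    callable_with m (final C1 p) & ~ holds Q (final C p)].

Lemma size_inputs : size (inputs (meth a)) = size doms.
Proof. by case: aa => /(method_domains va us) h _; apply: h. Qed.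

Lemma size_binding : size B = size doms.
Proof.
by case: aa => _; rewrite -/B => ->; rewrite -size_inputs; apply/eqP; rewrite -all_count.
Qed.

Lemma over_C1 : over sch C1.
Proof.
move=> S t; rewrite /C1 /of_facts inE => /orP[/eqP[-> ->]|/oC //].
by exists doms => //; apply: size_binding.
Qed.

Lemma consistent_C_C1 : consistent C C1.
Proof. exact: consistent_of_facts_cons. Qed.

Lemma C1_extend S t : C1 S t <-> extend C (a, fun t => t = B) S t.
Proof.
rewrite /C1 /of_facts /extend inE /= -/R; split=> [/orP[/eqP[-> ->]|]|].
- by right.
- by left.
by move=> [->|[-> ->]]; rewrite ?eqxx ?orbT.
Qed.

(** The witnessing path begins with the access returning the single tuple [B], which turns [C] into
    [C1]. *)
Lemma relevantI p i : path_on sch acs (full sch) C1 p ->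
  holds Q (final C1 p) -> truncated_at sch C p i ->
  ~ holds Q (final C (take i p)) -> long_term_relevant sch acs C a Q.
Proof.
move=> [sp wp] hQ ti nQ; exists (full sch), (fun t => t = B), p, i.
have oi : over sch (final C (take i p)).
  apply: (over_final oC (acs := acs)).
  by move: sp; rewrite -{1}(cat_take_drop i p) all_sound_cat => -[].
have hQ' : holds Q (final C ((a, fun t => t = B) :: p)).
  apply: holds_mono hQ => S t; rewrite /= !finalE C1_extend; tauto.
split.
  split; [exact: over_full | exact: oC | split=> //=].
    split=> // _ ->; split; first by exists doms => //; apply: size_binding.
    by apply: mask_all_true => //; rewrite size_binding size_inputs.
  split=> //; apply: all_well_formed_mono wp => S t; exact: (iffLR (C1_extend _ _)).
split=> //; last by rewrite certainE.
move=> I oI CI; apply: holds_mono hQ' => S t; exact: CI.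
Qed.

(** Run [p0] and then [p1]. The truncated path stops inside [p0], whose facts do not suffice for
    [Q], while the whole path also has those of [p1]. *)
Lemma relevant_by_truncation p0 p1 :
  path_on sch acs (full sch) C1 p0 -> ~ holds Q (final C p0) ->
  ~ all_well_formed sch C p0 ->
  path_on sch acs (full sch) C1 p1 -> holds Q (final C1 p1) ->
  long_term_relevant sch acs C a Q.
Proof.
move=> [sp0 wp0] nQ nwp0 [sp1 wp1] hQ.
have [i ti] := truncated_ex sch C (p0 ++ p1).
apply: (@relevantI (p0 ++ p1) i) => //.
- split; first by rewrite all_sound_cat.
  rewrite all_well_formed_cat; split=> //.
  exact/(all_well_formed_mono _ wp1)/consistent_final.
- apply: holds_mono hQ; apply: final_mono => // S t; rewrite gain_cat; tauto.
have [_ wi _] := ti; have ip0 : i < size p0.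
  rewrite ltnNge; apply/negP => p0i; apply: nwp0.
  move: wi; rewrite take_cat ltnNge p0i /= all_well_formed_cat.
  by case.
rewrite take_cat ip0 => hQi; apply: nQ; apply: holds_mono hQi.
by apply: final_mono => //; apply: consistent_take.
Qed.

Lemma useful_by_path_relevant : useful_by_path -> long_term_relevant sch acs C a Q.
Proof.
move=> [p [pp hQ nQ]]; have [i ti] := truncated_ex sch C p.
apply: (relevantI pp hQ ti) => hQi; apply: nQ; apply: holds_mono hQi.
by apply: final_mono => //; apply: consistent_take.
Qed.

Lemma useful_by_truncation_relevant :
  (forall S ts c, (S, ts) \in Q -> TConst c \in ts ->
     exists S' t, (S', t) \in conf /\ c \in t) ->
  useful_by_truncation -> long_term_relevant sch acs C a Q.
Proof.
move=> Qc [[p1 pp1 hQ] [m [D [p [[ma dm [mdoms ms Dm] [b bD nb]] pp cm nQ]]]]].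
have [wpC|nwpC] := classic (all_well_formed sch C p); last first.
  exact: relevant_by_truncation pp nQ nwpC pp1 hQ.
(* [Z] contains both the configuration and the binding, so a moved constant is larger than any
   constant of either. *)
pose Z := Cons (enc_names B) (enc_conf conf).
have ZC : dsize (enc_conf conf) <= dsize Z by rewrite /=; lia.
have bZ : dsize b <= dsize Z.
  have := dsize_enc_seq (fun v : name => v) (mem_zip_l bD).
  by rewrite -/(enc_names B) /=; lia.
have [sp _] := pp; pose p' := map (rename_step sch conf Z) p.
have sp' : all_sound acs (full sch) p' by apply: all_sound_rename.
have wp' : all_well_formed sch C p'.
  apply: all_well_formed_rename sp _ wpC => // v E vE.
  by rewrite rename_active.
have nQ' : ~ holds Q (final C p') by move/(holds_rename us ZC sp Qc).
(* Values for the call of [m]: [b] at the domain [D], where the access makes it known, and at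
   another input domain a value known after [p], renamed if it comes from a response. *)
have valP E : exists v, E \in mask (inputs m) mdoms ->
    active_domain sch (final C1 p') v E /\ (E = D -> v = b).
  have bC1 : active_domain sch (final C1 p') b D.
    apply: (@active_domain_mono _ C1); first exact: consistent_final.
    by apply/active_domain_cons; eauto.
  have [->|nED] := eqVneq E D; first by exists b.
  have [Em|nEm] := boolP (E \in mask (inputs m) mdoms); last by exists b.
  have [v /active_domain_final[vC|vp]] := cm _ _ ms Em.
    exists v => _; split; last by move=> eED; rewrite eED eqxx in nED.
    by apply: active_domain_mono vC; apply: consistent_final.
  exists (rename sch conf Z E v) => _.
  split; last by move=> eED; rewrite eED eqxx in nED.
  by apply/active_domain_final; right; apply: active_domain_rename.
pose val E := projT1 (constructive_indefinite_description _ (valP E)).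
have valE E (Em : E \in mask (inputs m) mdoms) :
    active_domain sch (final C1 p') (val E) E /\ (E = D -> val E = b).
  by rewrite /val; case: constructive_indefinite_description => v /= /(_ Em).
have smm := method_domains va us ma ms.
pose al := Access m (map val (mask (inputs m) mdoms)).
(* The call gets an empty response, so it adds no fact towards [Q]. *)
have gal S t : gain (p' ++ [:: (al, fun _ => False)]) S t <-> gain p' S t.
  by rewrite gain_cat gain_cons /gain /=; tauto.
apply: (@relevant_by_truncation (p' ++ [:: (al, fun _ => False)]) p1) => //.
- split; first rewrite all_sound_cat; first split=> //.
    by split=> //; split=> //=; rewrite size_map size_mask.
  rewrite all_well_formed_cat; split.
    by apply: all_well_formed_mono wp'; apply: consistent_C_C1.
  split=> // _ mdoms' v E /= ms'; rewrite (schema_fun us ms' ms) => vE.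
  by have [] := valE _ (mem_zip_r vE); rewrite (mem_zip_map vE).
- move=> hQ'; apply: nQ'; apply: holds_mono hQ'.
  by apply: final_mono => // S t /gal.
move=> /all_well_formed_cat[_ [/= wal _]].
(* After the renaming, [b] is still unknown at [D] without the access, which makes the added call
   ill-formed. *)
have nbp' : ~ active_domain sch (final C p') b D by apply: active_domain_renamed.
apply: nbp'; apply: (wal dm _ _ _ ms) => /=.
have [v vD] : exists v, (v, D) \in
    zip (map val (mask (inputs m) mdoms)) (mask (inputs m) mdoms).
  by apply: mem_zip_exists; rewrite ?size_map.
by have [_ /(_ erefl) <-] := valE _ Dm; rewrite -(mem_zip_map vD).
Qed.

Lemma relevant_useful : long_term_relevant sch acs C a Q ->
  useful_by_path \/ useful_by_truncation.
Proof.
move=> [I [r [p [i [[oI CI [[_ ra sp] [_ wp]]] [ti cQ ncQ]]]]]].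
have [ip wi maxi] := ti.
have {}sp : all_sound acs (full sch) p by apply: all_sound_full sp.
(* All attributes are inputs, so a response contains at most the tuple [B]. *)
have rB t : r t -> t = B.
  move=> /ra[/oI[d Rd st] /= mt]; rewrite /B -mt mask_all_true //.
  by rewrite st size_inputs (schema_fun us Rd Rdoms).
have oi : over sch (final C (take i p)).
  apply: (over_final oC (acs := acs)).
  by move: sp; rewrite -{1}(cat_take_drop i p) all_sound_cat => -[].
have {ncQ}nQ : ~ holds Q (final C (take i p)) by rewrite -(certainE _ oi).
have subC1 : consistent (extend C (a, r)) C1.
  by move=> S t [Ct|[/= eS /rB et]]; rewrite C1_extend; [left|right].
have hQ : holds Q (final C1 p).
  apply: (cQ (final C1 p)); first exact: over_final over_C1 sp.
  exact: (@final_mono (extend C (a, r)) C1 p p).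
have pp : path_on sch acs (full sch) C1 p.
  by split=> //; apply: all_well_formed_mono wp.
(* If the facts of [p] do not give [Q] without the access, the first situation holds. Otherwise the
   truncated path, which does not give [Q], is a proper prefix. *)
have [hQC|] := classic (holds Q (final C p)); last by left; exists p.
right; split; first by exists p.
have ltip : i < size p.
  rewrite ltnNge; apply/negP => pi; apply: nQ; by rewrite take_oversize.
case dp: (drop i p) => [|[al rl] p2].
  by have := size_drop i p; rewrite dp /=; lia.
have ep : p = take i p ++ (al, rl) :: p2 by rewrite -dp cat_take_drop.
(* The first dropped access [al] is ill-formed after the truncated path, though well-formed once the
   fact of the access is added. Some value in its binding is then known only through [B]. *)
have nwal : ~ well_formed sch (final C (take i p)) al.
  move=> wal; suff /(maxi i.+1 ltip) : all_well_formed sch C (take i.+1 p).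
    by rewrite ltnn.
  rewrite (take_nth (al, rl)) // -cats1 all_well_formed_cat; split=> //=.
  by rewrite -[i]addn0 -nth_drop dp addn0.
have [sp1 [[mal sal] _ _]] : all_sound acs (full sch) (take i p) /\
    all_sound acs (full sch) ((al, rl) :: p2) by rewrite -all_sound_cat -ep.
have [_] := pp; rewrite {1}ep all_well_formed_cat => -[wp1 [wal1 _]].
have [dal nwal'] := imply_to_and _ _ nwal.
have [mdoms ms sm] := va mal.
have [v [D [vD nvD]]] : exists v D,
    (v, D) \in zip (binding al) (mask (inputs (meth al)) mdoms) /\
    ~ active_domain sch (final C (take i p)) v D.
  apply: NNPP => nex; apply: nwal' => mdoms' v D ms'.
  rewrite (schema_fun us ms' ms) => vD; apply: NNPP => nvD.
  by apply: nex; exists v, D.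
(* The truncated path leads to the call without making [Q] true, and the binding of [al] shows that
   the input domains of its method are nonempty. *)
exists (meth al), D, (take i p); split=> //.
  split=> //; first by exists mdoms => //; apply: mem_zip_r vD.
  exists v; last first.
    by move=> vC; apply: nvD; apply/active_domain_final; left.
  have := wal1 dal _ _ _ ms vD; rewrite active_domain_final.
  rewrite (active_domain_cons _ _ _ _ us Rdoms) => -[[//|vC]|vp].
    by case: nvD; apply/active_domain_final; left.
  by case: nvD; apply/active_domain_final; right.
move=> mdoms' E ms'; rewrite (schema_fun us ms' ms) => Em.
have [|u uE] := mem_zip_exists (s := binding al) _ Em.
  by rewrite sal size_mask.
by exists u; apply: wal1 dal _ _ _ ms uE.
Qed.

End Characterization.

(** * Containment questions *)

Lemma not_containedE sch acs C Q1 Q2 : over sch C ->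
  ~ contained sch acs C Q1 Q2 <->
  exists p, [/\ path_on sch acs (full sch) C p, holds Q1 (final C p)
              & ~ holds Q2 (final C p)].
Proof.
move=> oC; split=> [nc|[p [pp hQ1 nQ2]] c].
  apply: NNPP => nex; apply: nc => C' /(reachableE _ _ oC)[p pp ->] hQ1.
  by apply: NNPP => nQ2; apply: nex; exists p.
by apply/nQ2/c => //; apply/reachableE => //; exists p.
Qed.

Lemma mask_map_zip (S T : Type) (q : pred T) (s : seq S) (t : seq T) :
  size s = size t -> mask (map q t) (zip s t) = [seq x <- zip s t | q x.2].
Proof.
by elim: s t => [|x s IHs] [|y t] //= [/IHs->]; case: (q y).
Qed.

(** [bits] marks the atoms guessed to be mapped to the fact of the access; a mark acts only on atoms
    over [R]. *)
Definition relabel (R N : name) (bits : seq bool) (Q : query) : query :=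
  [seq if x.1 && (x.2.1 == R) then (N, x.2.2) else x.2 | x <- zip bits Q].

(* [nN], [nK], [nP], [nW], [nF] name auxiliary relations: [nN] holds a copy of the
   tuple of the access, [nK] keeps its constants under the unused domain [F], [nP]
   tests which of them are in the active domain, [nW] tests whether a method can be
   called, and [nF] stays empty. *)
Section Questions.
Variables (sch : schema) (acs : seq method) (conf : seq (name * seq name)).
Variables (a : access) (Q : query) (doms wdoms : seq name).
Variables nN nK nP nW nF F : name.
Hypothesis us : valid_schema sch.
Hypothesis va : valid_methods sch acs.
Hypothesis oC : over sch (of_facts conf).
Hypothesis vQ : valid_query sch conf Q.
Hypothesis Rdoms : (rel (meth a), doms) \in sch.
Hypothesis sB : size (binding a) = size doms.
Hypothesis ufresh : uniq [:: nN; nK; nP; nW; nF].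
Hypothesis fresh : forall S ds,
  (S, ds) \in sch -> S \notin [:: nN; nK; nP; nW; nF] /\ F \notin ds.
Let R := rel (meth a).
Let B := binding a.
Let C := of_facts conf.

(** The columns of [nP] are reversed because the program obtains them by a traversal of [doms],
    which reverses. *)
Definition extended_schema : schema :=
  [:: (nN, doms), (nK, nseq (size B) F), (nP, rev doms), (nW, wdoms),
      (nF, [::]) & sch].
Let schP := extended_schema.
Let confN := (nN, B) :: conf.
Let confK := (nK, B) :: conf.
Let confR := (R, B) :: conf.
(** As [nF] stays empty, non-containment in this query says that some reachable configuration
    satisfies the other one. *)
Definition failing : query := [:: (nF, [::])].

Lemma valid_extended_schema : valid_schema schP.
Proof.
rewrite /valid_schema -[unzip1 _]/([:: nN; nK; nP; nW; nF] ++ unzip1 sch).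
rewrite cat_uniq ufresh us andbT; apply/hasPn => _ /mapP[[S ds] s ->].
by have [] := fresh s.
Qed.

Lemma extendedE S ds : S \notin [:: nN; nK; nP; nW; nF] ->
  ((S, ds) \in schP) = ((S, ds) \in sch).
Proof.
rewrite !inE !negb_or => /and5P[/negbTE h1 /negbTE h2 /negbTE h3 /negbTE h4 /negbTE h5].
by rewrite !xpair_eqE h1 h2 h3 h4 h5.
Qed.

Lemma extendedW S ds : (S, ds) \in sch -> (S, ds) \in schP.
Proof. by move=> s; rewrite !inE s !orbT. Qed.

Lemma method_fresh m : m \in acs -> rel m \notin [:: nN; nK; nP; nW; nF].
Proof. by case/va => ds /fresh[]. Qed.

Lemma over_C S t : C S t -> S \notin [:: nN; nK; nP; nW; nF].
Proof. by case/oC => ds /fresh[]. Qed.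

Lemma query_fresh S ts : (S, ts) \in Q -> S \notin [:: nN; nK; nP; nW; nF].
Proof. by case: vQ => h _ _ /h[ds /fresh[]]. Qed.

Lemma active_domain_extended C0 v D :
  (forall S t, C0 S t -> S \notin [:: nN; nK; nP; nW; nF]) ->
  active_domain schP C0 v D <-> active_domain sch C0 v D.
Proof.
move=> C0fr; split=> -[S [ds [t [s C0t vD]]]]; exists S, ds, t; split=> //.
  by rewrite -extendedE //; apply: C0fr C0t.
exact: extendedW.
Qed.

Lemma gain_fresh acs' I p S t :
  (forall m, m \in acs' -> rel m \notin [:: nN; nK; nP; nW; nF]) ->
  all_sound acs' I p -> gain p S t -> S \notin [:: nN; nK; nP; nW; nF].
Proof. by move=> fr sp /(gain_sound sp)[_ [m /fr mfr ->]]. Qed.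

(** The methods of [acs] access only relations of the old schema, so the auxiliary relations affect
    a path only through the initial active domain. *)
Lemma path_extended C0 C0' p :
  (forall v D, active_domain schP C0 v D <-> active_domain sch C0' v D) ->
  path_on schP acs (full schP) C0 p <-> path_on sch acs (full sch) C0' p.
Proof.
move=> ad; have schE m ds : m \in acs -> ((rel m, ds) \in schP) = ((rel m, ds) \in sch).
  by move/method_fresh/extendedE.
split=> -[sp wp]; split.
- apply: all_sound_transfer sp => m t ma [ds s st]; exists ds => //.
  by rewrite -schE.
- apply: all_well_formed_transfer sp wp => // v D; exact: (iffLR (ad v D)).
- apply: all_sound_transfer sp => m t ma [ds s st]; exists ds => //.
  by rewrite schE.
apply: all_well_formed_transfer sp wp => [m ds /schE->|v D] //.
exact: (iffRL (ad v D)).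
Qed.

Lemma over_extended C0 : over sch C0 -> over schP C0.
Proof. by move=> o S t /o[ds s st]; exists ds => //; apply: extendedW. Qed.

Lemma over_confN : over schP (of_facts confN).
Proof.
move=> S t; rewrite /of_facts inE => /orP[/eqP[-> ->]|/(over_extended oC)//].
by exists doms => //; rewrite !inE eqxx.
Qed.

Lemma over_confK : over schP (of_facts confK).
Proof.
move=> S t; rewrite /of_facts inE => /orP[/eqP[-> ->]|/(over_extended oC)//].
by exists (nseq (size B) F); rewrite ?size_nseq // !inE eqxx orbT.
Qed.

Lemma over_confR : over sch (of_facts confR).
Proof.
move=> S t; rewrite /of_facts inE => /orP[/eqP[-> ->]|/oC//].
by exists doms.
Qed.

Lemma active_domain_C v D : active_domain schP C v D <-> active_domain sch C v D.
Proof. exact/active_domain_extended/over_C. Qed.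

(** [nN] has the domains of the accessed relation, so its copy of [B] makes known exactly what the
    fact of the access would. *)
Lemma active_domain_confN v D :
  active_domain schP (of_facts confN) v D <-> active_domain sch (of_facts confR) v D.
Proof.
rewrite (active_domain_cons _ _ _ _ valid_extended_schema (doms0 := doms)); last first.
  by rewrite !inE eqxx.
by rewrite (active_domain_cons _ _ _ _ us Rdoms) active_domain_C.
Qed.

(** [F] occurs in no relation of the input, so keeping the constants of [B] under it reveals nothing
    at the other domains. *)
Lemma active_domain_confK v D : D != F ->
  active_domain schP (of_facts confK) v D <-> active_domain sch C v D.
Proof.
move=> nDF.
rewrite (active_domain_cons _ _ _ _ valid_extended_schema (doms0 := nseq (size B) F)).
  rewrite active_domain_C; split=> [[/mem_zip_r|//]|]; last by right.
  by rewrite mem_nseq (negbTE nDF) andbF.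
by rewrite !inE eqxx orbT.
Qed.

Lemma holds_C1_confN p : holds Q (final (of_facts confN) p) -> holds Q (final C p).
Proof.
move=> [nu nuP]; exists nu => S ts Sts.
have := nuP _ _ Sts; rewrite !finalE /of_facts inE => -[/orP[/eqP[eS _]|]|];
  [|by left|by right].
by have := query_fresh Sts; rewrite eS !inE eqxx.
Qed.

Lemma failing_fails acs' C0 p : (forall t, ~ C0 nF t) ->
  (forall m, m \in acs' -> rel m != nF) ->
  all_sound acs' (full schP) p -> ~ holds failing (final C0 p).
Proof.
move=> C0F acsF sp [nu /(_ nF [::])]; rewrite inE eqxx => /(_ isT)/finalE[/C0F//|].
by move/(gain_sound sp) => [_ [m /acsF mF e]]; rewrite -e eqxx in mF.
Qed.

Lemma names_neq :
  [/\ nP != nF, nF != nK, nP != nK & nW != nN].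
Proof.
move: ufresh; rewrite /= !inE !negb_or -!andbA.
do ![case/andP=> ?] => _.
by split=> //; rewrite eq_sym.
Qed.

(** * Meaning of the oracle questions *)

Lemma relabel_useful bits Q' : Q' =i relabel R nN bits Q -> size bits = size Q ->
  ~ contained schP acs (of_facts confN) Q' Q -> useful_by_path sch acs conf a Q.
Proof.
move=> eQ' sb /(not_containedE _ _ _ over_confN)[p [pp [nu nuP] nQ]].
have pp' := iffLR (path_extended _ active_domain_confN) pp; have [sp _] := pp'.
exists p; split=> //; last first.
  move=> hQ; apply/nQ/holds_mono/hQ; apply: final_mono => //.
  exact: consistent_of_facts_cons.
(* The same valuation works: an atom moved to [nN] can only be matched with the tuple [B], so its
   original over [R] is matched with the fact of the access. *)
exists nu => S ts Sts; have Sfr := query_fresh Sts.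
have [b bS] := mem_zip_exists sb Sts.
have := map_f (fun x => if x.1 && (x.2.1 == R) then (nN, x.2.2) else x.2) bS.
rewrite -/(relabel R nN bits Q) -eQ' /=; case: ifP => [/andP[_ /eqP->]|_] /nuP.
  rewrite !finalE /of_facts !inE => -[/orP[/eqP[->]|/over_C]|].
  - by left; rewrite eqxx.
  - by rewrite !inE eqxx.
  by move/(gain_fresh method_fresh sp); rewrite !inE eqxx.
rewrite !finalE /of_facts !inE => -[/orP[/eqP[e]|->]|]; last by right.
  by rewrite e !inE eqxx in Sfr.
by left; rewrite orbT.
Qed.

(** The relabelled query is taken up to the order of its atoms, since the program produces it
    reversed. *)
Lemma useful_relabel : useful_by_path sch acs conf a Q ->
  exists2 bits, size bits = size Q & forall Q', Q' =i relabel R nN bits Q ->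
  ~ contained schP acs (of_facts confN) Q' Q.
Proof.
move=> [p [pp [nu nuP] nQ]].
(* The marked atoms are those whose terms the valuation sends to [B]. *)
exists [seq map (subst nu) x.2 == B | x <- Q]; first by rewrite size_map.
move=> Q' eQ'; apply/(not_containedE _ _ _ over_confN); exists p; split.
- exact/(path_extended _ active_domain_confN).
- exists nu => S ts; rewrite eQ' /relabel => /mapP[[b [S' ts']] /= bS].
  have /= eb := mem_zip_map bS; have Sts' := mem_zip_r bS.
  rewrite eb; case: ifP => [/andP[/eqP e _] [-> ->]|neq [-> ->]].
    by apply/finalE; left; rewrite e /of_facts inE eqxx.
  have := nuP _ _ Sts'; rewrite !finalE => -[|?]; last by right.
  rewrite /of_facts !inE => /orP[/eqP[eS et]|->]; last by left; rewrite orbT.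
  by rewrite eS et !eqxx in neq.
by move/holds_C1_confN.
Qed.

Lemma reachable_query :
  ~ contained schP acs (of_facts confR) Q failing <->
  exists2 p, path_on sch acs (full sch) (of_facts confR) p
           & holds Q (final (of_facts confR) p).
Proof.
have frR S t : of_facts confR S t -> S \notin [:: nN; nK; nP; nW; nF].
  by case/over_confR => ds /fresh[].
have ad v D := active_domain_extended v D frR.
rewrite (not_containedE _ _ _ (over_extended over_confR)).
split=> [[p [/(path_extended _ ad) pp hQ _]]|[p pp hQ]]; first by exists p.
have [sp _] := iffRL (path_extended _ ad) pp.
exists p; split=> //; first exact/(path_extended _ ad).
apply: failing_fails sp => [t /frR|m /method_fresh].
  by rewrite !inE eqxx !orbT.
by apply: contra => /eqP->; rewrite !inE eqxx !orbT.
Qed.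

(** The inputs of the method on [nP] are the columns whose domain satisfies [q]. All columns
    together test the well-formedness of the access; a single domain tests whether the values of [B]
    at it are known. *)
Lemma well_formed_question (q : pred name) dep :
  ~ contained schP [:: Method nP (map q (rev doms)) dep] (of_facts confK)
      [:: (nP, map TConst (rev B))] failing <->
  (dep -> forall v D, (v, D) \in zip B doms -> q D -> active_domain sch C v D).
Proof.
set m := Method _ _ _; set rd := rev doms.
have Pin : (nP, rd) \in schP by rewrite !inE eqxx !orbT.
have rdE ds : (nP, ds) \in schP -> ds = rd.
  by move=> s; apply: schema_fun valid_extended_schema s Pin.
have srB : size (rev B) = size rd by rewrite !size_rev.
have zipE v D : ((v, D) \in zip (rev B) rd) = ((v, D) \in zip B doms).
  by rewrite -rev_zip // mem_rev.
have nDF v D : (v, D) \in zip B doms -> D != F.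
  have [_ Fd] := fresh Rdoms.
  by move=> /mem_zip_r Dd; apply: contraNneq Fd => <-.
rewrite (not_containedE _ _ _ over_confK); split; last first.
  (* One access that returns the required tuple at once is enough. *)
  move=> wf; exists [:: (Access m (mask (map q rd) (rev B)), fun t => t = rev B)].
  have sp : all_sound [:: m] (full schP)
      [:: (Access m (mask (map q rd) (rev B)), fun t => t = rev B)].
    split=> //; first split; rewrite ?inE //= ?size_mask ?size_map //.
    by move=> _ ->; split=> //; exists rd.
  split.
  - split=> //; split=> // /wf{}wf ds v D /rdE-> /=.
    rewrite -mask_zip mask_map_zip // mem_filter /= zipE => /andP[qD vD].
    by apply/active_domain_confK; [apply: nDF vD | apply: wf].
  - exists (fun x => x) => S ts; rewrite inE => /eqP[-> ->].
    by right; split=> //=; rewrite -map_comp map_id.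
  apply: failing_fails sp => [t|m']; last first.
    by rewrite inE => /eqP->; case: names_neq.
  rewrite /of_facts inE => /orP[/eqP[e _]|/over_C]; last by rewrite !inE eqxx !orbT.
  by case: names_neq; rewrite e eqxx.
move=> [p [[sp wp] [nu nuP] _]] dep1 v D vD qD.
have {nuP} := nuP _ _ (mem_head _ _); rewrite -map_comp map_id finalE.
move=> -[|gp].
  rewrite /of_facts inE => /orP[/eqP[e _]|/over_C]; last by rewrite !inE eqxx !orbT.
  by case: names_neq; rewrite e eqxx.
(* Invariant along the path: at the tested domains nothing is known beyond the active domain of [C].
   A returned tuple repeats the binding in the tested columns, and a dependent access binds only
   known values there. *)
have : forall v D, D \in doms -> q D ->
    active_domain schP (of_facts confK) v D -> active_domain sch C v D.
  move=> u E Ed _; rewrite active_domain_confK //.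
  by have [_ Fd] := fresh Rdoms; apply: contraNneq Fd => <-.
have inD u E : (u, E) \in zip B doms -> E \in doms by apply: mem_zip_r.
elim: p (of_facts confK) sp wp gp => [//|[[m' bi] r] p IHp] C0 /=.
move=> [[/= mm' _] ra sp] [wa wp] gp cl.
have em : m' = m by apply/eqP; rewrite inE in mm'.
subst m'.
have newP t u E : r t -> (u, E) \in zip t rd -> E \in doms -> q E ->
    active_domain sch C u E.
  move=> /ra[[ds /rdE-> st] /= mt] uE Ed qE; apply: cl => //.
  apply: (wa dep1 rd _ _ Pin); rewrite /= -mt -mask_zip mask_map_zip //.
  by rewrite mem_filter /= qE.
move: gp => /gain_cons[[_ /= rB]|gp].
  by apply: newP rB _ _ _; rewrite ?zipE // (inD v).
apply: IHp sp wp gp _ => u E Ed qE [S [ds [t [s [C0t|[/= eS rt]] uE]]]].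
  by apply: cl => //; exists S, ds, t.
by apply: newP rt _ Ed qE; rewrite -(rdE ds) // -eS.
Qed.

(** Only [mW] produces facts of its relation, so the path can be cut at the first call of [mW]. *)
Lemma first_call acs' mW I p t : all_sound (mW :: acs') I p -> gain p (rel mW) t ->
  (forall m, m \in acs' -> rel m != rel mW) ->
  exists p1 al p2, [/\ p = p1 ++ al :: p2, all_sound acs' I p1, meth al.1 = mW
                      & size (binding al.1) = count id (inputs mW)].
Proof.
move=> sp gp acsW; elim: p sp gp => [//|[al r] p IHp] /= [[mal sal] ra sp].
move: mal; rewrite inE => /orP[/eqP em _|mal].
  by exists [::], (al, r), p; split=> //=; rewrite -em.
move/gain_cons => [[/= e _]|/(IHp sp)[p1 [al' [p2 [-> sp1 em sb]]]]].
  by have := acsW _ mal; rewrite e eqxx.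
by exists ((al, r) :: p1), al', p2; split.
Qed.

(** The variables of the query are named after the domains. This types the query and asks for one
    value per domain, which is how the values of a call are chosen. *)
Lemma callable_question m : m \in acs -> dependent m -> (rel m, wdoms) \in sch ->
  ~ contained schP (Method nW (inputs m) (dependent m) :: acs) (of_facts confN)
      [:: (nW, map TVar wdoms)] Q <->
  exists p, [/\ path_on sch acs (full sch) (of_facts confR) p,
    callable_with sch m (final (of_facts confR) p) & ~ holds Q (final C p)].
Proof.
move=> ma dm ms; set mW := Method _ _ _.
have Win : (nW, wdoms) \in schP by rewrite !inE eqxx !orbT.
have WE ds : (nW, ds) \in schP -> ds = wdoms.
  by move=> s; apply: schema_fun valid_extended_schema s Win.
have sm := method_domains va us ma ms.
have acsW m' : m' \in acs -> rel m' != nW.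
  by move=> /method_fresh; apply: contra => /eqP->; rewrite !inE eqxx !orbT.
have ad p : all_sound acs (full schP) p -> forall v D,
    active_domain schP (final (of_facts confN) p) v D <->
    active_domain sch (final (of_facts confR) p) v D.
  move=> sp v D; rewrite (active_domain_final schP) (active_domain_final sch).
  rewrite active_domain_confN.
  rewrite (active_domain_extended (C0 := gain p)) // => S t.
  exact: gain_fresh method_fresh sp.
have fullT t : size t = size wdoms -> full schP nW t by exists wdoms.
rewrite (not_containedE _ _ _ over_confN); split; last first.
  move=> [p [pp cm nQ]].
  have [sp wp] := iffRL (path_extended _ active_domain_confN) pp.
  have valP E : exists v, E \in mask (inputs m) wdoms ->
      active_domain sch (final (of_facts confR) p) v E.
    have [Em|nEm] := boolP (E \in mask (inputs m) wdoms); last by exists E.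
    by have [v vE] := cm _ _ ms Em; exists v.
  pose val E := projT1 (constructive_indefinite_description _ (valP E)).
  have valE E : E \in mask (inputs m) wdoms ->
      active_domain sch (final (of_facts confR) p) (val E) E.
    by rewrite /val; case: constructive_indefinite_description.
  (* After [p], one call of the copy returns the tuple of the chosen values; at domains that are no
     inputs these are arbitrary. *)
  exists (p ++ [:: (Access mW (map val (mask (inputs m) wdoms)),
                    fun t => t = map val wdoms)]); split.
  - split; first rewrite all_sound_cat; first split.
    + by apply: all_sound_incl sp => m' ma'; rewrite inE ma' orbT.
    + split=> //; first by split; rewrite ?inE ?eqxx //= size_map size_mask.
      by move=> _ ->; split; [apply: fullT; rewrite size_map | rewrite map_mask].
    rewrite all_well_formed_cat; split=> //; split=> // _ ds v E /WE-> /= vE.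
    apply/(ad _ sp); rewrite (mem_zip_map vE); apply: valE.
    exact: mem_zip_r vE.
  - exists val => S ts; rewrite inE => /eqP[-> ->].
    apply/finalE; right; apply/gain_cat; right; apply/gain_cons; left; split=> //=.
    by rewrite -map_comp.
  move=> [nu nuP]; apply: nQ; exists nu => S ts Sts.
  have Sfr := query_fresh Sts.
  have := nuP _ _ Sts; rewrite finalE gain_cat gain_cons => -[|[|[[/= e _]|//]]].
  - rewrite /of_facts inE => /orP[/eqP[e _]|?]; last by apply/finalE; left.
    by rewrite e !inE eqxx in Sfr.
  - by move=> ?; apply/finalE; right.
  by rewrite e !inE eqxx !orbT in Sfr.
move=> [p [[sp wp] [nu nuP] nQ]].
have := nuP _ _ (mem_head _ _); rewrite finalE => -[|gp].
  rewrite /of_facts inE => /orP[/eqP[e _]|/over_C]; last by rewrite !inE eqxx !orbT.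
  by case: names_neq; rewrite e eqxx.
(* The part before the first call of the copy uses only [acs], and the binding of that call
   witnesses that the input domains of [m] are nonempty. *)
have [p1 [[al r] [p2 [ep sp1 /= eal sal]]]] := first_call sp gp acsW.
move: wp; rewrite ep all_well_formed_cat /= => -[wp1 [wal _]].
exists p1; split.
- by apply/(path_extended _ active_domain_confN).
- move=> ds E /(schema_fun us ms)<- Em.
  have [|u uE] := mem_zip_exists (s := binding al) _ Em.
    by rewrite sal size_mask.
  exists u; apply/(ad _ sp1); apply: (wal _ wdoms); rewrite ?eal //.
move=> hQ; apply: nQ; apply: holds_mono hQ; apply: final_mono.
  exact: consistent_of_facts_cons.
by move=> S t; rewrite ep gain_cat; left.
Qed.

(** * Legality of the oracle questions *)

Lemma extended_fun n ds ds' : (n, ds) \in schP -> (n, ds') \in schP -> ds' = ds.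
Proof. by move=> s /(schema_fun valid_extended_schema s). Qed.

Lemma valid_methods_extended : valid_methods schP acs.
Proof. by move=> m /va[ds s sz]; exists ds => //; apply: extendedW. Qed.

Lemma valid_query_extended f : valid_query schP (f :: conf) Q.
Proof.
case: vQ => ar [tau ty] cst; split=> [S ts /ar[ds s sz]||S ts c Sts /(cst _ _ _ Sts)].
- by exists ds => //; apply: extendedW.
- exists tau => S ts ds x D Sts; rewrite extendedE ?(query_fresh Sts) //; exact: ty.
by move=> [S' [t [tF ct]]]; exists S', t; rewrite inE tF orbT.
Qed.

Lemma valid_failing conf' : valid_query schP conf' failing.
Proof.
split=> [S ts||S ts c].
- by rewrite inE => /eqP[-> ->]; exists [::]; rewrite // !inE eqxx !orbT.
- by exists id => S ts ds x D; rewrite inE => /eqP[_ ->]; case: ds.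
by rewrite inE => /eqP[_ ->].
Qed.

(** [nN] has the domains of [R], so moving an atom there keeps the typing of its variables. *)
Lemma valid_relabel bits Q' : size bits = size Q -> Q' =i relabel R nN bits Q ->
  valid_query schP confN Q'.
Proof.
move=> sb eQ'.
have inQ' S ts : (S, ts) \in Q' -> (S, ts) \in Q \/ S = nN /\ (R, ts) \in Q.
  rewrite eQ' => /mapP[[b [S' ts']] /mem_zip_r /= S'Q].
  case: ifP => [/andP[_ /eqP eS] [-> ->]|_ [-> ->]]; last by left.
  by right; split; rewrite // -eS.
have Nin : (nN, doms) \in schP by rewrite inE eqxx.
have [ar [tau ty] cst] := valid_query_extended (nN, B).
split=> [S ts /inQ'[/ar//|[-> /ar[ds s sz]]]||S ts c /inQ'[/cst|[_ /cst]]].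
- by exists doms => //; rewrite (extended_fun s (extendedW Rdoms)).
- exists tau => S ts ds x D /inQ'[Sts|[-> Rts] /(extended_fun Nin)->].
    exact: ty Sts.
  exact: ty Rts (extendedW Rdoms).
- exact.
- exact.
Qed.

(** The constants of a legal query occur in the configuration; [nK] provides those of [B]. *)
Lemma valid_constants : valid_query schP confK [:: (nP, map TConst (rev B))].
Proof.
split=> [S ts||S ts c].
- rewrite inE => /eqP[-> ->]; exists (rev doms); rewrite ?size_map ?size_rev //.
  by rewrite !inE eqxx !orbT.
- exists id => S ts ds x D; rewrite inE => /eqP[_ ->] _ /mem_zip_l.
  by case/mapP.
rewrite inE => /eqP[_ ->] /mapP[c' c'B [->]].
by exists nK, B; split; [rewrite /confK inE eqxx | rewrite -mem_rev].
Qed.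

Lemma valid_call conf' : valid_query schP conf' [:: (nW, map TVar wdoms)].
Proof.
have Win : (nW, wdoms) \in schP by rewrite !inE eqxx !orbT.
split=> [S ts||S ts c].
- by rewrite inE => /eqP[-> ->]; exists wdoms; rewrite ?size_map.
- exists id => S ts ds x D; rewrite inE => /eqP[-> ->] /(extended_fun Win)->.
  by move/mem_zip_map => [].
by rewrite inE => /eqP[_ ->] /mapP[].
Qed.

Lemma valid_methods_testing ins dep : size ins = size doms ->
  valid_methods schP [:: Method nP ins dep].
Proof.
move=> sz m; rewrite inE => /eqP->; exists (rev doms); rewrite ?size_rev //.
by rewrite !inE eqxx !orbT.
Qed.

Lemma valid_methods_call m : m \in acs -> (rel m, wdoms) \in sch ->
  valid_methods schP (Method nW (inputs m) (dependent m) :: acs).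
Proof.
move=> ma ms m'; rewrite inE => /orP[/eqP->|]; last exact: valid_methods_extended.
exists wdoms; last exact: (method_domains va us ma ms).
by rewrite !inE eqxx !orbT.
Qed.

End Questions.

(** * Polynomial time *)

(** The base [n + 2] is at least 2, so that raising the exponent absorbs constants and sums. *)
Definition poly (f : nat -> nat) : Prop := exists k, forall n, f n <= (n + 2) ^ k.

Lemma leq_pow2 x k k' : k <= k' -> (x + 2) ^ k <= (x + 2) ^ k'.
Proof. by move=> kk'; rewrite leq_exp2l //; lia. Qed.

Lemma poly_const c : poly (fun=> c).
Proof.
exists c => n; apply: leq_trans (ltnW (ltn_expl c (ltnSn 1))) _.
by case: c => // c; rewrite leq_exp2r //; lia.
Qed.

Lemma poly_id : poly (fun n => n).
Proof. by exists 1 => n; rewrite expn1; lia. Qed.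

Lemma poly_add f g : poly f -> poly g -> poly (fun n => f n + g n).
Proof.
move=> [k fk] [l gl]; exists (k + l).+1 => n.
have := fk n; have := gl n; rewrite expnS.
have := leq_pow2 n (leq_addr l k); have := leq_pow2 n (leq_addl k l).
nia.
Qed.

Lemma poly_mul f g : poly f -> poly g -> poly (fun n => f n * g n).
Proof.
by move=> [k fk] [l gl]; exists (k + l) => n; rewrite expnD leq_mul.
Qed.

Lemma poly_comp f g : poly f -> poly g -> poly (fun n => f (g n)).
Proof.
move=> [k fk] [l gl]; exists ((l + 2) * k) => n; apply: leq_trans (fk _) _.
case: k {fk} => [|k]; first by rewrite muln0.
rewrite expnM leq_exp2r // expnD; have := gl n.
have : 0 < (n + 2) ^ l by rewrite expn_gt0; lia.
rewrite -mulnn; nia.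
Qed.

(** For positive [n] one has [n + 2 <= 3 * n]; the number [3 ^ k] then serves as coefficient, as
    exponent and, for [n = 0], as additive term. *)
Lemma poly_input f : poly f -> exists k, forall n, f n <= k * n ^ k + k.
Proof.
move=> [k fk]; exists (3 ^ k) => n; apply: leq_trans (fk n) _.
case: n => [|n].
  apply: leq_trans (leq_addl _ _); rewrite add0n.
  by case: (k) => // k'; rewrite leq_exp2r.
apply: leq_trans (leq_addr _ _).
apply: (@leq_trans (3 ^ k * n.+1 ^ k)).
  by rewrite -expnMn; case: (k) => // k'; rewrite leq_exp2r //; lia.
by rewrite leq_mul2l leq_pexp2l ?orbT //; apply/ltnW/ltn_expl.
Qed.

(** Chosen so that evaluation costs at most the weight times a bound on the variables read. A
    subexpression counts twice where its value can reappear in the result: for its own cost and for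
    the size of that result. *)
Fixpoint expr_weight (e : expr) : nat :=
  match e with
  | Var _ | ENil => 1
  | ECons e1 e2 => 1 + 2 * expr_weight e1 + 2 * expr_weight e2
  | EHd e1 | ETl e1 => 2 * expr_weight e1
  | EEq e1 e2 => 3 + expr_weight e1 + expr_weight e2
  end.

Fixpoint expr_vars (e : expr) : seq nat :=
  match e with
  | Var x => [:: x]
  | ENil => [::]
  | ECons e1 e2 | EEq e1 e2 => expr_vars e1 ++ expr_vars e2
  | EHd e1 | ETl e1 => expr_vars e1
  end.

Lemma eval_le_ecost s e : dsize (eval s e) <= ecost s e.
Proof. by case: e => *; apply: leq_addr. Qed.

Lemma ecost_le s e M : 0 < M -> (forall x, x \in expr_vars e -> dsize (s x) <= M) ->
  ecost s e <= expr_weight e * M.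
Proof.
move=> M0; elim: e => [x||e1 IH1 e2 IH2|e1 IH1|e1 IH1|e1 IH1 e2 IH2] /= sM.
- by rewrite addn0 mul1n sM ?inE.
- lia.
- have := eval_le_ecost s e1; have := eval_le_ecost s e2.
  have /IH1 : forall x, x \in expr_vars e1 -> dsize (s x) <= M.
    by move=> x xe; apply: sM; rewrite mem_cat xe.
  have /IH2 : forall x, x \in expr_vars e2 -> dsize (s x) <= M.
    by move=> x xe; apply: sM; rewrite mem_cat xe orbT.
  nia.
- have := IH1 sM; have := eval_le_ecost s e1.
  have : dsize (if eval s e1 is Cons d _ then d else Nil) <= dsize (eval s e1).
    by case: (eval s e1) => //= d1 d2; lia.
  nia.
- have := IH1 sM; have := eval_le_ecost s e1.
  have : dsize (if eval s e1 is Cons _ d then d else Nil) <= dsize (eval s e1).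
    by case: (eval s e1) => //= d1 d2; lia.
  nia.
have /IH1 : forall x, x \in expr_vars e1 -> dsize (s x) <= M.
  by move=> x xe; apply: sM; rewrite mem_cat xe.
have /IH2 : forall x, x \in expr_vars e2 -> dsize (s x) <= M.
  by move=> x xe; apply: sM; rewrite mem_cat xe orbT.
have : dsize (enc_bool (eval s e1 == eval s e2)) <= 3 by case: (_ == _).
nia.
Qed.

(** * Commands that run in polynomial time *)

Definition bounded_store (M : nat) (s : store) : Prop := forall x, dsize (s x) <= M.

Lemma bounded_store_gt0 M s : bounded_store M s -> 0 < M.
Proof. by move=> /(_ 0); have := dsize_gt0 (s 0); lia. Qed.

Lemma bounded_store_le M M' s : M <= M' -> bounded_store M s -> bounded_store M' s.
Proof. by move=> MM' sM x; apply: leq_trans (sM x) MM'. Qed.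

Lemma bounded_upd M s x d : bounded_store M s -> dsize d <= M ->
  bounded_store M (upd s x d).
Proof. by move=> sM dM y; rewrite /upd; case: eqP. Qed.

Lemma ecost_bounded M s e : bounded_store M s -> ecost s e <= expr_weight e * M.
Proof. by move=> sM; apply: ecost_le => // ; apply: bounded_store_gt0 sM. Qed.

(** Termination is included, for all guesses. The bound covers the final store as well as the time,
    so that running commands in sequence composes polynomials. *)
Definition polytime (O : data -> Prop) (c : cmd) : Prop :=
  exists2 f, poly f & forall M s w, bounded_store M s ->
  exists t s' w', [/\ run O c (s, w) t (s', w'), t <= f M & bounded_store (f M) s'].

Lemma polytime_assign O x e : polytime O (Assign x e).
Proof.
exists (fun n => n + (expr_weight e * n + 1)) => [|M s w sM].
  apply: poly_add poly_id _; apply: poly_add; last exact: poly_const.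
  exact: poly_mul (poly_const _) poly_id.
have := ecost_bounded e sM; have := eval_le_ecost s e => le1 le2.
exists (ecost s e).+1, (upd s x (eval s e)), w; split; [exact: RunAssign | lia |].
by apply: bounded_upd; [apply: bounded_store_le sM|]; lia.
Qed.

Lemma polytime_ask O x e : polytime O (Ask x e).
Proof.
exists (fun n => n + (expr_weight e * n + 3)) => [|M s w sM].
  apply: poly_add poly_id _; apply: poly_add; last exact: poly_const.
  exact: poly_mul (poly_const _) poly_id.
have := ecost_bounded e sM => le1.
have [yes|no] := classic (O (eval s e)).
  exists (ecost s e).+1, (upd s x (enc_bool true)), w.
  split; [exact: RunAskYes | lia |].
  by apply: bounded_upd; [apply: bounded_store_le sM|rewrite /=]; lia.
exists (ecost s e).+1, (upd s x (enc_bool false)), w.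
split; [exact: RunAskNo | lia |].
by apply: bounded_upd; [apply: bounded_store_le sM|rewrite /=]; lia.
Qed.

Lemma polytime_seq O c1 c2 : polytime O c1 -> polytime O c2 -> polytime O (Seq c1 c2).
Proof.
move=> [f pf fP] [g pg gP]; exists (fun n => f n + (g (f n) + 1)) => [|M s w sM].
  exact: poly_add pf (poly_add (poly_comp pg pf) (poly_const _)).
have [t1 [s1 [w1 [r1 t1M s1M]]]] := fP M s w sM.
have [t2 [s2 [w2 [r2 t2M s2M]]]] := gP _ s1 w1 s1M.
exists (t1 + t2).+1, s2, w2; split; [exact: RunSeq r1 r2 | lia |].
by apply: bounded_store_le s2M; lia.
Qed.

Lemma polytime_if O e c1 c2 : polytime O c1 -> polytime O c2 -> polytime O (If e c1 c2).
Proof.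
move=> [f pf fP] [g pg gP].
exists (fun n => f n + (g n + (expr_weight e * n + 1))) => [|M s w sM].
  apply: poly_add pf (poly_add pg (poly_add _ (poly_const _))).
  exact: poly_mul (poly_const _) poly_id.
have := ecost_bounded e sM => le1.
have [eN|nN] := eqVneq (eval s e) Nil.
  have [t [s' [w' [r tM s'M]]]] := gP M s w sM.
  exists (ecost s e + t).+1, s', w'; split; [exact: RunIfFalse r | lia |].
  by apply: bounded_store_le s'M; lia.
have [t [s' [w' [r tM s'M]]]] := fP M s w sM.
exists (ecost s e + t).+1, s', w'; split; [exact: RunIfTrue r | lia |].
by apply: bounded_store_le s'M; lia.
Qed.

(** * Traversal of lists *)

Definition dhd (d : data) : data := if d is Cons x _ then x else Nil.
Definition dtl (d : data) : data := if d is Cons _ x then x else Nil.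
Fixpoint elems (d : data) : seq data := if d is Cons x d' then x :: elems d' else [::].

Definition push (Y : nat) (oe : option expr) : cmd :=
  if oe is Some e then Assign Y (ECons e (Var Y)) else Skip.

(* Traverses in parallel the two lists of the pair in variable 1; with [ch], a fresh
   guess is in variable 2 at each turn. *)
Definition while_push (ch : bool) (Y : nat) (g : expr) (e1 : expr)
    (oe2 : option expr) : cmd :=
  While (EHd (Var 1))
    (Seq (if ch then Choose 2 else Skip)
      (Seq (If g (push Y (Some e1)) (push Y oe2))
        (Assign 1 (ECons (ETl (EHd (Var 1))) (ETl (ETl (Var 1))))))).

Definition collect_list (ch : bool) (Y : nat) (l1 l2 g e1 : expr)
    (oe2 : option expr) : cmd :=
  Seq (Assign 1 (ECons l1 l2)) (Seq (Assign Y ENil) (while_push ch Y g e1 oe2)).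

Definition ovars (oe : option expr) := if oe is Some e then expr_vars e else [::].
Definition oweight (oe : option expr) := if oe is Some e then expr_weight e else 0.

(** The list collected in [Y] is bounded apart from the rest of the store. The pushed expressions do
    not read [Y], so each turn adds an amount bounded by the other variables, and the list grows
    additively. *)
Definition bounded_off (Y M : nat) (s : store) : Prop :=
  forall x, x != Y -> dsize (s x) <= M.

Lemma ecost_off Y M s e : bounded_off Y M s -> 0 < M -> Y \notin expr_vars e ->
  ecost s e <= expr_weight e * M.
Proof.
by move=> sM M0 Ye; apply: ecost_le => // x xe; apply: sM; apply: contraNneq Ye => <-.
Qed.

Lemma bounded_off_upd Y M s x d : bounded_off Y M s -> (x != Y -> dsize d <= M) ->
  bounded_off Y M (upd s x d).
Proof.
move=> sM dM y yY; rewrite /upd; case: eqVneq => [yx|_]; last exact: sM.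
by apply: dM; rewrite -yx.
Qed.

Lemma push_cost O Y oe s w M U : bounded_off Y M s -> 0 < M ->
  Y \notin ovars oe -> dsize (s Y) <= U ->
  exists t s', [/\ run O (push Y oe) (s, w) t (s', w),
    t <= 3 + 2 * (oweight oe * M) + 2 * U, bounded_off Y M s',
    dsize (s' Y) <= dsize (s Y) + oweight oe * M + 1
    & s' 1 = (if 1 == Y then s' 1 else s 1)].
Proof.
case: oe => [e|] sM M0 Ye sU; last first.
  exists 1, s; split=> //; first [exact: RunSkip | lia | by case: eqP].
have := ecost_off sM M0 Ye; have := eval_le_ecost s e => le1 le2.
exists (ecost s (ECons e (Var Y))).+1, (upd s Y (eval s (ECons e (Var Y)))).
split; [exact: RunAssign | rewrite /=; lia | | |].
- by apply: bounded_off_upd => //; rewrite eqxx.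
- by rewrite /upd eqxx /=; lia.
by rewrite /upd; case: (1 == Y).
Qed.

(** [U] bounds the collected list throughout, as each of the [n] turns adds at most [K * M] to it.
    The 40 in [K] pays for the loop test, the guess and the passage to the tails. *)
Lemma while_push_cost O ch Y g e1 oe2 M U n : 2 < Y -> 3 <= M ->
  Y \notin expr_vars g ++ expr_vars e1 ++ ovars oe2 ->
  let K := expr_weight g + 2 * expr_weight e1 + 2 * oweight oe2 + 40 in
  forall s w, size (elems (dhd (s 1))) = n -> bounded_off Y M s ->
  dsize (s Y) + n * (K * M) <= U ->
  exists t s' w', [/\ run O (while_push ch Y g e1 oe2) (s, w) t (s', w'),
    t <= n.+1 * (K * M + 2 * U), bounded_off Y M s' & dsize (s' Y) <= U].
Proof.
move=> Y2 M3; rewrite !mem_cat !negb_or => /and3P[Yg Ye1 Ye2] K.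
have M0 : 0 < M by lia.
have Y1 : 1 != Y by lia.
elim: n => [|n IHn] s w sz sM sU.
  have hd0 : dhd (s 1) = Nil by case: (dhd (s 1)) sz.
  exists (ecost s (EHd (Var 1))).+1, s, w; split=> //; last by lia.
    by apply: RunWhileFalse.
  have := ecost_off sM M0 (e := EHd (Var 1)); rewrite inE eq_sym Y1 => /(_ isT).
  rewrite /K [expr_weight (EHd _)]/=; nia.
have [x [r1 [r2 s1E]]] : exists x r1 r2, s 1 = Cons (Cons x r1) r2.
  by case: (s 1) sz => // -[//|x r1] r2; exists x, r1, r2.
have guard : eval s (EHd (Var 1)) != Nil by rewrite /= s1E.
pose pre := if ch then Choose 2 else Skip.
have [s0 [w0 [run0 s0M s0Y s01]]] : exists s0 w0,
    [/\ run O pre (s, w) 1 (s0, w0), bounded_off Y M s0, s0 Y = s Y & s0 1 = s 1].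
  rewrite /pre; case: (ch); last by exists s, w; split=> //; apply: RunSkip.
  exists (upd s 2 (enc_bool (w 0))), (fun i => w i.+1); split=> //.
  - exact: RunChoose.
  - by apply: bounded_off_upd => // _; case: (w 0) => /=; lia.
  by rewrite /upd; case: eqP => //; lia.
have KM : K * M = expr_weight g * M + 2 * (expr_weight e1 * M)
    + 2 * (oweight oe2 * M) + 40 * M by rewrite /K; lia.
have sU' : dsize (s Y) + K * M + n * (K * M) <= U by rewrite -addnA -mulSn.
have [t2 [s2 [run2 t2M s2M s2Y s21]]] : exists t s',
  [/\ run O (If g (push Y (Some e1)) (push Y oe2)) (s0, w0) t (s', w0),
      t <= 4 + expr_weight g * M + 2 * (expr_weight e1 * M) + 2 * (oweight oe2 * M)
           + 2 * U, bounded_off Y M s',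
      dsize (s' Y) <= dsize (s Y) + expr_weight e1 * M + oweight oe2 * M + 1
    & s' 1 = s 1].
  have s0U : dsize (s0 Y) <= U by rewrite s0Y; lia.
  have gM := ecost_off s0M M0 Yg.
  have [gN|gN] := eqVneq (eval s0 g) Nil.
    have [t [s' [r tM s'M s'Y]]] := push_cost O w0 s0M M0 Ye2 s0U.
    rewrite (negbTE Y1) s01 => s'1; exists (ecost s0 g + t).+1, s'; split=> //.
    - exact: RunIfFalse.
    - lia.
    by rewrite -s0Y; lia.
  have [t [s' [r tM s'M s'Y]]] := push_cost O w0 s0M M0 (oe := Some e1) Ye1 s0U.
  rewrite (negbTE Y1) s01 => s'1; exists (ecost s0 g + t).+1, s'; split=> //.
  - exact: RunIfTrue.
  - by move: tM => /=; lia.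
  by move: s'Y; rewrite -s0Y /=; lia.
pose nx := ECons (ETl (EHd (Var 1))) (ETl (ETl (Var 1))).
have nxM : ecost s2 nx <= 17 * M.
  apply: leq_trans (ecost_off s2M M0 (e := nx) _) _; last by rewrite leq_mul2r orbT.
  by rewrite /= !inE ![Y == 1]eq_sym (negbTE Y1).
pose s3 := upd s2 1 (eval s2 nx).
have s3M : bounded_off Y M s3.
  apply: bounded_off_upd => // _; have := sM 1 Y1; rewrite s1E /nx /= s21 s1E /=.
  have := dsize_gt0 x; case: (r2) => //= d1 d2; lia.
have s3Y : dsize (s3 Y) + n * (K * M) <= U.
  rewrite /s3 /upd eq_sym (negbTE Y1); nia.
have [|t4 [s4 [w4 [run4 t4M s4M s4Y]]]] := IHn s3 w0 _ s3M s3Y.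
  by rewrite /s3 /upd eqxx /nx /= s21 s1E /=; move: sz; rewrite s1E /= => -[].
exists (ecost s (EHd (Var 1)) + (1 + (t2 + (ecost s2 nx).+1).+1).+1 + t4).+1, s4, w4.
split=> //.
  apply: RunWhileTrue guard _ run4.
  apply: RunSeq run0 _; apply: RunSeq run2 _; exact: RunAssign.
have := ecost_off sM M0 (e := EHd (Var 1)); rewrite inE eq_sym Y1 => /(_ isT).
rewrite [expr_weight (EHd _)]/= mulSn; lia.
Qed.

Lemma size_elems d : size (elems d) <= dsize d.
Proof. by elim: d => //= d1 _ d2; lia. Qed.

Lemma polytime_collect O ch Y l1 l2 g e1 oe2 : 2 < Y ->
  Y \notin expr_vars g ++ expr_vars e1 ++ ovars oe2 ->
  polytime O (collect_list ch Y l1 l2 g e1 oe2).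
Proof.
move=> Y2 Yv; apply: polytime_seq; first exact: polytime_assign.
apply: polytime_seq; first exact: polytime_assign.
set K := expr_weight g + 2 * expr_weight e1 + 2 * oweight oe2 + 40.
pose f n := n + 3 + (n * (K * (n + 3)) + n).
exists (fun n => f n + (n + 1) * (K * (n + 3) + 2 * f n)).
  have pf : poly f by rewrite /f; do ?[apply: poly_add | apply: poly_mul |
    apply: poly_const | apply: poly_id].
  by do ?[apply: poly_add | apply: poly_mul | apply: poly_const | apply: poly_id |
    apply: pf].
move=> M s w sM.
have sz : size (elems (dhd (s 1))) <= M.
  apply: leq_trans (size_elems _) _; apply: leq_trans (sM 1).
  by case: (s 1) => //= d1 d2; lia.
(* The summand 3 leaves room for a guess, since an encoded Boolean has size at most 3. *)
have off : bounded_off Y (M + 3) s by move=> x _; apply: leq_trans (sM x) _; lia.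
have [||t [s' [w' [r tM s'M s'Y]]]] :=
  while_push_cost O ch (M := M + 3) (U := f M) Y2 _ Yv w erefl off.
- lia.
- rewrite -/K /f; have := sM Y.
  have : size (elems (dhd (s 1))) * (K * (M + 3)) <= M * (K * (M + 3)).
    by rewrite leq_mul2r sz orbT.
  lia.
exists t, s', w'; split=> //.
  apply: leq_trans tM _; apply: leq_trans (leq_addl _ _).
  by rewrite leq_mul2r; apply/orP; right; lia.
move=> x; apply: leq_trans (leq_addr _ _); case: (eqVneq x Y) => [->//|/s'M].
by rewrite /f; lia.
Qed.

(** * Partial correctness *)

(** The weakest liberal precondition; termination is supplied separately by [polytime]. *)
Definition wp (O : data -> Prop) (c : cmd) (Q : state -> Prop) (st : state) : Prop :=
  forall t st', run O c st t st' -> Q st'.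

Lemma wp_skip O (Q : state -> Prop) st : Q st -> wp O Skip Q st.
Proof. by move=> q t st' r; inversion r; subst. Qed.

Lemma wp_assign O x e (Q : state -> Prop) s w :
  Q (upd s x (eval s e), w) -> wp O (Assign x e) Q (s, w).
Proof. by move=> q t st' r; inversion r; subst. Qed.

Lemma wp_seq O c1 c2 Q st : wp O c1 (wp O c2 Q) st -> wp O (Seq c1 c2) Q st.
Proof. by move=> q t st' r; inversion r; subst; apply: q; eassumption. Qed.

Lemma wp_if O e c1 c2 Q s w :
  wp O (if eval s e != Nil then c1 else c2) Q (s, w) -> wp O (If e c1 c2) Q (s, w).
Proof.
move=> q t st' r; inversion r; subst; apply: q; first by rewrite H6; eassumption.
by rewrite H6; eassumption.
Qed.

Lemma wp_choose O x (Q : state -> Prop) s w :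
  Q (upd s x (enc_bool (w 0)), fun n => w n.+1) -> wp O (Choose x) Q (s, w).
Proof. by move=> q t st' r; inversion r; subst. Qed.

Lemma wp_ask O x e (Q : state -> Prop) s w :
  (forall b : bool, b <-> O (eval s e) -> Q (upd s x (enc_bool b), w)) ->
  wp O (Ask x e) Q (s, w).
Proof. by move=> q t st' r; inversion r; subst; apply: q; split. Qed.

Lemma wp_while O e c Q s w :
  (eval s e = Nil -> Q (s, w)) ->
  (eval s e != Nil -> wp O c (wp O (While e c) Q) (s, w)) ->
  wp O (While e c) Q (s, w).
Proof.
move=> q0 q1 t st' r; inversion r; subst; last exact: q0.
by apply: q1; eassumption.
Qed.

Lemma wp_weaken O c (Q Q' : state -> Prop) st :
  (forall st', Q st' -> Q' st') -> wp O c Q st -> wp O c Q' st.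
Proof. by move=> QQ' q t st' /q/QQ'. Qed.

(** The items pushed by the loop, in order. Each turn consumes one guess and one item of [l2], read
    as [Nil] once [l2] is exhausted. *)
Fixpoint collected (f : bool -> data -> data -> option data) (w : nat -> bool)
    (l1 : seq data) (l2 : data) : seq data :=
  if l1 is x :: l1' then
    seq_of_opt (f (w 0) x (dhd l2)) ++ collected f (fun i => w i.+1) l1' (dtl l2)
  else [::].

(** [f] stands for one turn of the body, as a function of the guess and the two current items. The
    induction is on the number of items left, with any initial content of [Y]. *)
Lemma wp_while_push O (ch : bool) Y g e1 oe2 f (Q : state -> Prop) (s : store) w :
  2 < Y ->
  (forall (s1 : store) c x r1 r2, (forall v, v != 1 -> v != 2 -> v != Y -> s1 v = s v) ->
     s1 1 = Cons (Cons x r1) r2 -> (ch -> s1 2 = enc_bool c) ->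
     f c x (dhd r2) =
       if eval s1 g != Nil then Some (eval s1 e1) else omap (eval s1) oe2) ->
  (forall s' : store, (forall v, v != 1 -> v != 2 -> v != Y -> s' v = s v) ->
     let l1 := elems (dhd (s 1)) in
     s' Y = foldl (fun acc z => Cons z acc) (s Y)
              (collected f (if ch then w else fun=> false) l1 (dtl (s 1))) ->
     Q (s', if ch then fun i => w (size l1 + i) else w)) ->
  wp O (while_push ch Y g e1 oe2) Q (s, w).
Proof.
move=> Y2 fE.
have [n] := ubnP (size (elems (dhd (s 1)))); elim: n => // n IHn in s w fE *.
move=> szn q; apply: wp_while => [/= hd0|].
  have l0 : elems (dhd (s 1)) = [::].
    by move: hd0; rewrite -[X in X = _]/(dhd (s 1)) => ->.
  move: q; rewrite l0 /= => q.
  rewrite [w in (s, w)](_ : w = if ch then fun i => w (0 + i) else w); last by case: (ch).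
  exact: q.
move=> hdN.
have [x [r1 [r2 s1E]]] : exists x r1 r2, s 1 = Cons (Cons x r1) r2.
  by move: hdN => /=; case: (s 1) => // -[//|x r1] r2; exists x, r1, r2.
pose c := if ch then w 0 else false.
pose w1 := if ch then (fun i => w i.+1) else w.
apply: wp_seq.
suff loop (s1 : store) : (forall v, v != 2 -> s1 v = s v) -> (ch -> s1 2 = enc_bool c) ->
    wp O (Seq (If g (push Y (Some e1)) (push Y oe2))
      (Assign 1 (ECons (ETl (EHd (Var 1))) (ETl (ETl (Var 1))))))
      (wp O (while_push ch Y g e1 oe2) Q) (s1, w1).
  rewrite /w1 /c in loop *; case: (ch) in loop *.
    by apply: wp_choose; apply: loop => [v vN|_]; rewrite /upd ?eqxx // (negbTE vN).
  by apply: wp_skip; apply: loop.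
move=> s1s s12; apply: wp_seq.
have s1E1 : s1 1 = Cons (Cons x r1) r2 by rewrite s1s.
have fx := fE s1 c x r1 r2 (fun v _ v2 _ => s1s v v2) s1E1 s12.
suff step (s2 : store) : (forall v, v != Y -> s2 v = s1 v) ->
    s2 Y = foldl (fun acc z => Cons z acc) (s1 Y) (seq_of_opt (f c x (dhd r2))) ->
    wp O (Assign 1 (ECons (ETl (EHd (Var 1))) (ETl (ETl (Var 1)))))
      (wp O (while_push ch Y g e1 oe2) Q) (s2, w1).
  apply: wp_if; case: ifP fx => [_ fx|_]; [|case: (oe2) step => [e2|] step /= fx].
  - by apply: wp_assign; apply: step => [v vY|]; rewrite /upd ?eqxx ?fx // (negbTE vY).
  - by apply: wp_assign; apply: step => [v vY|]; rewrite /upd ?eqxx ?fx // (negbTE vY).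
  by apply: wp_skip; apply: step; rewrite ?fx.
move=> s2s s2Y; apply: wp_assign.
have s2E1 : s2 1 = Cons (Cons x r1) r2 by rewrite s2s //; lia.
rewrite /= s2E1; set s3 := upd _ _ _.
have s31 : s3 1 = Cons r1 (dtl r2) by [].
have s3s v : v != 1 -> v != 2 -> v != Y -> s3 v = s v.
  by move=> v1 v2 vY; rewrite /s3 /upd (negbTE v1) s2s // s1s.
have s3Y : s3 Y = s2 Y by rewrite /s3 /upd; case: eqP => // e; lia.
move: s3 s31 s3s s3Y => s3 s31 s3s s3Y.
apply: IHn => [s4 c' x' r1' r2' s4s||].
- by apply: fE => v v1 v2 vY; rewrite s4s // s3s.
- by move: szn; rewrite s31 s1E /=; lia.
move=> s' s's; rewrite s31 /= s3Y s2Y -foldl_cat (s1s Y) => [s'Y|]; last by lia.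
have {q} := q s'; rewrite s1E /= /w1 /c in s'Y *; case: (ch) in s'Y * => q;
  apply: q => //;
  by move=> v v1 v2 vY; rewrite s's // s3s.
Qed.

Lemma foldl_rev_enc acc l :
  foldl (fun acc z => Cons z acc) acc l = foldr Cons acc (rev l).
Proof. by rewrite -{1}[l]revK foldl_rev. Qed.

Definition shift_by (ch : bool) (n : nat) (w : nat -> bool) : nat -> bool :=
  if ch then fun i => w (n + i) else w.

(** The traversal overwrites the work variables 1 and 2, so the postcondition is required for all
    values [a] and [b] left there. *)
Lemma wp_collect_list O (ch : bool) Y l1 l2 g e1 oe2 f (Q : state -> Prop) (s : store) w :
  2 < Y ->
  (forall (s1 : store) c x r1 r2,
     (forall v, v != 1 -> v != 2 -> v != Y -> s1 v = s v) ->
     s1 1 = Cons (Cons x r1) r2 -> (ch -> s1 2 = enc_bool c) ->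
     f c x (dhd r2) =
       if eval s1 g != Nil then Some (eval s1 e1) else omap (eval s1) oe2) ->
  (forall a b,
     Q (upd (upd (upd s 1 a) 2 b) Y
          (enc_names (rev (collected f (if ch then w else fun=> false)
                             (elems (eval s l1)) (eval s l2)))),
        shift_by ch (size (elems (eval s l1))) w)) ->
  wp O (collect_list ch Y l1 l2 g e1 oe2) Q (s, w).
Proof.
move=> Y2 fE q; apply: wp_seq; apply: wp_assign; apply: wp_seq; apply: wp_assign.
set s0 := upd _ _ _.
have s01 : s0 1 = Cons (eval s l1) (eval s l2).
  by rewrite /s0 /upd; case: eqP => //; lia.
have s0s v : v != 1 -> v != 2 -> v != Y -> s0 v = s v.
  by move=> v1 v2 vY; rewrite /s0 /upd (negbTE v1) (negbTE vY).
apply: (wp_while_push Y2 (f := f)) => [s1 c x r1 r2 s1s|s' s's].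
  by apply: fE => v v1 v2 vY; rewrite s1s // s0s.
have s0Y : s0 Y = Nil by rewrite /s0 /upd eqxx.
rewrite s01 s0Y; cbv zeta; rewrite foldl_rev_enc => s'Y.
suff -> : s' = upd (upd (upd s 1 (s' 1)) 2 (s' 2)) Y (s' Y) by rewrite s'Y; apply: q.
apply: functional_extensionality => v; rewrite /upd.
case: eqP => [->//|/eqP vY]; case: eqP => [->//|/eqP v2]; case: eqP => [->//|/eqP v1].
by rewrite s's // s0s.
Qed.

Definition collect1 (f : data -> option data) (l : data) : data :=
  enc_names (rev (pmap f (elems l))).

Definition collect2 (f : bool -> data -> data -> option data) (w : nat -> bool)
    (l1 l2 : data) : data :=
  enc_names (rev (collected f w (elems l1) l2)).

Lemma collected_pmap f w l1 l2 : collected (fun _ x _ => f x) w l1 l2 = pmap f l1.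
Proof. by elim: l1 w l2 => //= x l1 IH w l2; rewrite IH; case: (f x). Qed.

Lemma wp_collect1 O Y l1 g e1 oe2 f (Q : state -> Prop) (s : store) w :
  2 < Y ->
  (forall (s1 : store) x r1 r2,
     (forall v, v != 1 -> v != 2 -> v != Y -> s1 v = s v) ->
     s1 1 = Cons (Cons x r1) r2 ->
     f x = if eval s1 g != Nil then Some (eval s1 e1) else omap (eval s1) oe2) ->
  (forall a b, Q (upd (upd (upd s 1 a) 2 b) Y (collect1 f (eval s l1)), w)) ->
  wp O (collect_list false Y l1 ENil g e1 oe2) Q (s, w).
Proof.
move=> Y2 fE q; apply: (wp_collect_list Y2 (f := fun _ x _ => f x)).
  by move=> s1 c x r1 r2 s1s s11 _; apply: fE s1s s11.
by move=> a b; rewrite collected_pmap; apply: q.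
Qed.

(** * The algorithm *)

Definition tt_data : data := Cons Nil Nil.

Fixpoint num (i : nat) : data := if i is i'.+1 then Cons Nil (num i') else Nil.
Definition aux_name (d : data) (i : nat) : data := Cons d (num i).

Definition in_sch (d : data) : data := dhd d.
Definition in_acs (d : data) : data := dhd (dtl d).
Definition in_conf (d : data) : data := dhd (dtl (dtl d)).
Definition in_acc (d : data) : data := dhd (dtl (dtl (dtl d))).
Definition in_query (d : data) : data := dtl (dtl (dtl (dtl d))).
Definition in_meth (d : data) : data := dhd (in_acc d).
Definition in_binding (d : data) : data := dtl (in_acc d).

Definition meth_rel (m : data) : data := dhd m.
Definition meth_inputs (m : data) : data := dhd (dtl m).
Definition meth_dep (m : data) : data := dtl (dtl m).

Definition lookup (R x : data) : option data :=
  if dhd x == R then Some (dtl x) else None.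
Definition domains_in (sch R : data) : data := dhd (collect1 (lookup R) sch).
(** A membership test by traversal: the collected list is [Nil] exactly when [m] does not occur. *)
Definition hits (m x : data) : option data := if x == m then Some Nil else None.
(** The guess and the relation name are compared as one pair, so that a single equality expresses
    the conjunction, as in the guard of the program. *)
Definition relabelled (d : data) (c : bool) (x _ : data) : option data :=
  if Cons (enc_bool c) (dhd x) == Cons tt_data (meth_rel (in_meth d))
  then Some (Cons (aux_name d 0) (dtl x)) else Some x.
Definition picked (c : bool) (x _ : data) : option data :=
  if enc_bool c != Nil then Some x else None.
Definition picked_input (c : bool) (x y : data) : option data :=
  if Cons (enc_bool c) x == Cons tt_data tt_data then Some y else None.

Definition question (sch acs conf Q1 Q2 : data) : data :=
  Cons sch (Cons acs (Cons conf (Cons Q1 Q2))).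

Definition single (d : data) : data := Cons d Nil.

(* [Q'] is the guessed relabelling of the query, [m] the guessed method, and [Ds] a list
   of guessed domains of inputs of [m], of which only the head counts.  The names
   [aux_name d i] for i = 0, ..., 4 are the relations [nN], [nK], [nP], [nW] and [nF]
   above; they and the domain [d] are larger than all names in the input. *)
Definition verdict (O : data -> Prop) (d Q' m Ds : data) : Prop :=
  let sch := in_sch d in let acs := in_acs d in let conf := in_conf d in
  let B := in_binding d in let Q := in_query d in let a := in_meth d in
  let doms := domains_in sch (meth_rel a) in
  let wdoms := domains_in sch (meth_rel m) in
  let sch' :=
    Cons (Cons (aux_name d 0) doms)
   (Cons (Cons (aux_name d 1) (collect1 (fun _ => Some d) B))
   (Cons (Cons (aux_name d 2) (collect1 Some doms))
   (Cons (Cons (aux_name d 3) wdoms)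
   (Cons (Cons (aux_name d 4) Nil) sch)))) in
  let confN := Cons (Cons (aux_name d 0) B) conf in
  let confK := Cons (Cons (aux_name d 1) B) conf in
  let confR := Cons (Cons (meth_rel a) B) conf in
  let fail := single (Cons (aux_name d 4) Nil) in
  let consts := single (Cons (aux_name d 2)
                  (collect1 (fun x => Some (Cons tt_data x)) B)) in
  let testing inputs dep := single (Cons (aux_name d 2) (Cons inputs dep)) in
  [/\ O (question sch acs conf Q Q), O (question sch acs confR Q Q),
      collect1 (hits a) acs <> Nil, collect1 (hits Nil) (meth_inputs a) = Nil
    & ~ O (question sch' (testing (meth_inputs a) (meth_dep a)) confK consts fail)] /\
  (~ O (question sch' acs confN Q' Q) \/
   [/\ ~ O (question sch' acs confR Q fail),
       O (question sch' (testing (collect1 (fun x => Some (enc_bool (x == dhd Ds))) doms)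
            tt_data) confK consts fail),
       ~ O (question sch'
            (Cons (Cons (aux_name d 3) (Cons (meth_inputs m) (meth_dep m))) acs) confN
            (single (Cons (aux_name d 3)
               (collect1 (fun x => Some (Cons Nil x)) (collect1 Some wdoms)))) Q),
       meth_dep m <> Nil & Ds <> Nil]).

(** * The text of the program *)

Definition e_tt : expr := ECons ENil ENil.
Fixpoint e_num (i : nat) : expr := if i is i'.+1 then ECons ENil (e_num i') else ENil.
Definition e_name (i : nat) : expr := ECons (Var 0) (e_num i).
Definition e_single (e : expr) : expr := ECons e ENil.
Definition e_list (es : seq expr) : expr := foldr ECons ENil es.

Definition e_sch : expr := EHd (Var 0).
Definition e_acs : expr := EHd (ETl (Var 0)).
Definition e_conf : expr := EHd (ETl (ETl (Var 0))).
Definition e_acc : expr := EHd (ETl (ETl (ETl (Var 0)))).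
Definition e_query : expr := ETl (ETl (ETl (ETl (Var 0)))).
Definition e_meth : expr := EHd e_acc.
Definition e_binding : expr := ETl e_acc.
Definition e_rel (e : expr) : expr := EHd e.
Definition e_inputs (e : expr) : expr := EHd (ETl e).
Definition e_dep (e : expr) : expr := ETl (ETl e).
Definition e_doms : expr := EHd (Var 10).
Definition e_m : expr := EHd (Var 17).
Definition e_wdoms : expr := EHd (Var 18).
Definition item1 : expr := EHd (EHd (Var 1)).
Definition item2 : expr := EHd (ETl (Var 1)).

Definition e_question (sch acs conf Q1 Q2 : expr) : expr :=
  ECons sch (ECons acs (ECons conf (ECons Q1 Q2))).

Definition e_sch' : expr :=
  ECons (ECons (e_name 0) e_doms)
 (ECons (ECons (e_name 1) (Var 13))
 (ECons (ECons (e_name 2) (Var 15))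
 (ECons (ECons (e_name 3) e_wdoms)
 (ECons (ECons (e_name 4) ENil) e_sch)))).
Definition e_confN : expr := ECons (ECons (e_name 0) e_binding) e_conf.
Definition e_confK : expr := ECons (ECons (e_name 1) e_binding) e_conf.
Definition e_confR : expr := ECons (ECons (e_rel e_meth) e_binding) e_conf.
Definition e_fail : expr := e_single (ECons (e_name 4) ENil).
Definition e_consts : expr := e_single (ECons (e_name 2) (Var 14)).
Definition e_testing (inputs dep : expr) : expr :=
  e_single (ECons (e_name 2) (ECons inputs dep)).

(* Each traversal reverses the list that it collects: the columns of the third auxiliary
   relation (variables 14, 15 and 20) stay reversed, while the terms in variable 22 are
   put back in order by way of variable 21. *)
Definition program_lists : cmd :=
  Seq (collect_list false 10 e_sch ENil (EEq (EHd item1) (e_rel e_meth)) (ETl item1) None)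
 (Seq (collect_list false 11 e_acs ENil (EEq item1 e_meth) ENil None)
 (Seq (collect_list false 12 (e_inputs e_meth) ENil (EEq item1 ENil) ENil None)
 (Seq (collect_list false 13 e_binding ENil e_tt (Var 0) None)
 (Seq (collect_list false 14 e_binding ENil e_tt (ECons e_tt item1) None)
 (Seq (collect_list false 15 e_doms ENil e_tt item1 None)
 (Seq (collect_list true 16 e_query ENil
        (EEq (ECons (Var 2) (EHd item1)) (ECons e_tt (e_rel e_meth)))
        (ECons (e_name 0) (ETl item1)) (Some item1))
 (Seq (collect_list true 17 e_acs ENil (Var 2) item1 None)
 (Seq (collect_list false 18 e_sch ENil (EEq (EHd item1) (e_rel e_m)) (ETl item1) None)
 (Seq (collect_list true 19 (e_inputs e_m) e_wdoms
        (EEq (ECons (Var 2) item1) (ECons e_tt e_tt)) item2 None)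
 (Seq (collect_list false 20 e_doms ENil e_tt (EEq item1 (EHd (Var 19))) None)
 (Seq (collect_list false 21 e_wdoms ENil e_tt item1 None)
      (collect_list false 22 (Var 21) ENil e_tt (ECons ENil item1) None)))))))))))).

Definition program_questions : cmd :=
  Seq (Ask 31 (e_question e_sch e_acs e_conf e_query e_query))
 (Seq (Ask 32 (e_question e_sch e_acs e_confR e_query e_query))
 (Seq (Ask 33 (e_question e_sch' (e_testing (e_inputs e_meth) (e_dep e_meth))
                e_confK e_consts e_fail))
 (Seq (Ask 34 (e_question e_sch' e_acs e_confN (Var 16) e_query))
 (Seq (Ask 35 (e_question e_sch' e_acs e_confR e_query e_fail))
 (Seq (Ask 36 (e_question e_sch' (e_testing (Var 20) e_tt) e_confK e_consts e_fail))
      (Ask 37 (e_question e_sch'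
                (ECons (ECons (e_name 3) (ECons (e_inputs e_m) (e_dep e_m))) e_acs)
                e_confN (e_single (ECons (e_name 3) (Var 22))) e_query))))))).

(** Conjunctions are tested by comparing a list of answers with the list of expected ones; that a
    variable is not [Nil] appears as an equality test expected to fail. *)
Definition program_verdict : cmd :=
  If (EEq (e_list [:: Var 31; Var 32; EEq (Var 11) ENil; Var 12; Var 33])
          (e_list [:: e_tt; e_tt; ENil; ENil; ENil]))
     (If (EEq (Var 34) ENil) (Assign 0 e_tt)
        (If (EEq (e_list [:: Var 35; Var 36; Var 37; EEq (e_dep e_m) ENil;
                             EEq (Var 19) ENil])
                 (e_list [:: ENil; e_tt; ENil; ENil; ENil]))
            (Assign 0 e_tt) (Assign 0 ENil)))
     (Assign 0 ENil).

Definition program : cmd :=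
  Seq program_lists (Seq program_questions program_verdict).

Lemma polytime_program O : polytime O program.
Proof.
rewrite /program /program_lists /program_questions /program_verdict.
by do ?[apply: polytime_collect => // | apply: polytime_seq | apply: polytime_ask
  | apply: polytime_if | apply: polytime_assign].
Qed.

(** * What the program computes *)

Lemma guardE (T : Type) (b : bool) (x y : T) :
  (if enc_bool b != Nil then x else y) = if b then x else y.
Proof. by case: b. Qed.

Lemma cons_eqE a b c d : (Cons a b == Cons c d) = (a == c) && (b == d).
Proof. by []. Qed.

Lemma enc_bool_eq_tt b : (enc_bool b == tt_data) = b.
Proof. by case: b. Qed.

Lemma enc_bool_eq_nil b : (enc_bool b == Nil) = ~~ b.
Proof. by case: b. Qed.

Lemma wp_program_verdict O s w (b31 b32 b33 b34 b35 b36 b37 : bool) :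
  s 31 = enc_bool b31 -> s 32 = enc_bool b32 -> s 33 = enc_bool b33 ->
  s 34 = enc_bool b34 -> s 35 = enc_bool b35 -> s 36 = enc_bool b36 ->
  s 37 = enc_bool b37 ->
  wp O program_verdict (fun st => accepting st <->
    [/\ b31, b32, s 11 <> Nil, s 12 = Nil & ~ b33] /\
    (~ b34 \/ [/\ ~ b35, b36, ~ b37, meth_dep (dhd (s 17)) <> Nil & s 19 <> Nil])) (s, w).
Proof.
move=> e31 e32 e33 e34 e35 e36 e37.
set V := _ /\ _; have acc (e : expr) (P : Prop) : (eval s e != Nil) <-> P ->
    (V <-> P) -> wp O (Assign 0 e) (fun st => accepting st <-> V) (s, w).
  move=> eP VP; apply: wp_assign; rewrite /accepting /=.
  by rewrite -[upd _ _ _ _]/(eval s e) eP VP.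
pose base := [&& b31, b32, s 11 != Nil, s 12 == Nil & ~~ b33].
pose second := [&& ~~ b35, b36, ~~ b37, meth_dep (dhd (s 17)) != Nil & s 19 != Nil].
have VE : V <-> base && (~~ b34 || second).
  rewrite /V /base /second; split.
    move=> [[-> -> /eqP-> -> /negP->] [/negP->|[/negP-> -> /negP-> /eqP-> /eqP->]]] //.
    by rewrite orbT eqxx.
  move=> /andP[/and5P[-> -> /eqP ? /eqP ? /negP ?]] /orP[/negP ?|].
    by split; [split|left].
  by move=> /and5P[/negP ? ? /negP ? /eqP ? /eqP ?]; split; [split|right; split].
apply: wp_if.
rewrite [eval _ _](_ : _ = enc_bool base); last first.
  rewrite /= e31 e32 e33; congr enc_bool; rewrite /base.
  by rewrite !cons_eqE !enc_bool_eq_tt !enc_bool_eq_nil eqxx andbT.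
rewrite guardE; case: ifP => hb; last by apply: (acc _ False); rewrite //= VE hb.
apply: wp_if.
rewrite [eval _ _](_ : _ = enc_bool (~~ b34)); last by rewrite /= e34 enc_bool_eq_nil.
rewrite guardE; case: ifP => h34; first by apply: (acc _ True); rewrite //= VE hb h34.
apply: wp_if.
rewrite [eval _ _](_ : _ = enc_bool second); last first.
  rewrite /= e35 e36 e37; congr enc_bool; rewrite /second.
  by rewrite !cons_eqE !enc_bool_eq_tt !enc_bool_eq_nil eqxx andbT.
rewrite guardE; case: ifP => hs; first by apply: (acc _ True); rewrite //= VE hb h34 hs.
by apply: (acc _ False); rewrite //= VE hb h34 hs.
Qed.

Lemma wp_collect1E O Y l1 v g e1 f (Q : state -> Prop) (s : store) w : 2 < Y ->
  eval s l1 = v ->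
  (forall (s1 : store) x r1 r2,
     (forall v, v != 1 -> v != 2 -> v != Y -> s1 v = s v) ->
     s1 1 = Cons (Cons x r1) r2 ->
     f x = if eval s1 g != Nil then Some (eval s1 e1) else None) ->
  (forall a b, Q (upd (upd (upd s 1 a) 2 b) Y (collect1 f v), w)) ->
  wp O (collect_list false Y l1 ENil g e1 None) Q (s, w).
Proof. by move=> Y2 <- fE q; apply: (wp_collect1 Y2 (oe2 := None) fE q). Qed.

Lemma wp_collect2E O Y l1 v l2 v2 g e1 oe2 f (Q : state -> Prop) (s : store) w : 2 < Y ->
  eval s l1 = v -> eval s l2 = v2 ->
  (forall (s1 : store) c x r1 r2,
     (forall v, v != 1 -> v != 2 -> v != Y -> s1 v = s v) ->
     s1 1 = Cons (Cons x r1) r2 -> s1 2 = enc_bool c ->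
     f c x (dhd r2) =
       if eval s1 g != Nil then Some (eval s1 e1) else omap (eval s1) oe2) ->
  (forall a b, Q (upd (upd (upd s 1 a) 2 b) Y (collect2 f w v v2),
                  shift_by true (size (elems v)) w)) ->
  wp O (collect_list true Y l1 l2 g e1 oe2) Q (s, w).
Proof.
move=> Y2 <- <- fE q; apply: (wp_collect_list (ch := true) (f := f) Y2) => //.
move=> s1 c x r1 r2 s1s s11 s12; exact: fE s1s s11 (s12 isT).
Qed.

Definition lists_computed (d Q' m Ds : data) (s : store) : Prop :=
  let doms := domains_in (in_sch d) (meth_rel (in_meth d)) in
  let wdoms := domains_in (in_sch d) (meth_rel m) in
  [/\ s 0 = d, dhd (s 10) = doms, s 11 = collect1 (hits (in_meth d)) (in_acs d),
      s 12 = collect1 (hits Nil) (meth_inputs (in_meth d))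
    & s 13 = collect1 (fun _ => Some d) (in_binding d)] /\
  [/\ s 14 = collect1 (fun x => Some (Cons tt_data x)) (in_binding d),
      s 15 = collect1 Some doms, s 16 = Q' & dhd (s 17) = m] /\
  [/\ dhd (s 18) = wdoms, s 19 = Ds,
      s 20 = collect1 (fun x => Some (enc_bool (x == dhd Ds))) doms
    & s 22 = collect1 (fun x => Some (Cons Nil x)) (collect1 Some wdoms)].

(** The guesses are consumed in this order: one per atom of the query, one per method, one per input
    flag of the guessed method. The shifts below skip those already consumed. *)
Definition guessed_query (d : data) (w : nat -> bool) : data :=
  collect2 (relabelled d) w (in_query d) Nil.
Definition guessed_method (d : data) (w : nat -> bool) : data :=
  dhd (collect2 picked (shift_by true (size (elems (in_query d))) w) (in_acs d) Nil).
Definition guessed_domains (d : data) (w : nat -> bool) : data :=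
  let m := guessed_method d w in
  collect2 picked_input
    (shift_by true (size (elems (in_acs d)))
       (shift_by true (size (elems (in_query d))) w))
    (meth_inputs m) (domains_in (in_sch d) (meth_rel m)).

Lemma wp_program_lists O d w :
  wp O program_lists (fun st => lists_computed d (guessed_query d w)
    (guessed_method d w) (guessed_domains d w) st.1) (init d, w).
Proof.
pose doms := domains_in (in_sch d) (meth_rel (in_meth d)).
apply: wp_seq.
apply: (@wp_collect1E _ _ _ (in_sch d) _ _ (lookup (meth_rel (in_meth d)))) => //.
  by move=> s1 x r1 r2 s1s s11; rewrite /lookup -guardE /= s11 ?s1s.
move=> a1 b1.
apply: wp_seq; apply: (@wp_collect1E _ _ _ (in_acs d) _ _ (hits (in_meth d))) => //.
  by move=> s1 x r1 r2 s1s s11; rewrite /hits -guardE /= s11 ?s1s.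
move=> a2 b2.
apply: wp_seq.
apply: (@wp_collect1E _ _ _ (meth_inputs (in_meth d)) _ _ (hits Nil)) => //.
  by move=> s1 x r1 r2 s1s s11; rewrite /hits -guardE /= s11 ?s1s.
move=> a3 b3.
apply: wp_seq; apply: (@wp_collect1E _ _ _ (in_binding d) _ _ (fun _ => Some d)) => //.
  by move=> s1 x r1 r2 s1s s11; rewrite /= s1s.
move=> a4 b4.
apply: wp_seq.
apply: (@wp_collect1E _ _ _ (in_binding d) _ _ (fun x => Some (Cons tt_data x))) => //.
  by move=> s1 x r1 r2 s1s s11; rewrite /= s11.
move=> a5 b5.
apply: wp_seq; apply: (@wp_collect1E _ _ _ doms _ _ Some) => //.
  by move=> s1 x r1 r2 s1s s11; rewrite /= s11.
move=> a6 b6.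
apply: wp_seq; apply: (@wp_collect2E _ _ _ (in_query d) _ Nil _ _ _ (relabelled d)) => //.
  by move=> s1 c x r1 r2 s1s s11 s12; rewrite /relabelled -guardE /= s11 s12 ?s1s.
move=> a7 b7; set w1 := shift_by _ _ _.
apply: wp_seq; apply: (@wp_collect2E _ _ _ (in_acs d) _ Nil _ _ _ picked) => //.
  by move=> s1 c x r1 r2 s1s s11 s12; rewrite /picked /= s11 s12.
move=> a8 b8; set w2 := shift_by _ _ w1; pose m := guessed_method d w.
pose wdoms := domains_in (in_sch d) (meth_rel m).
apply: wp_seq; apply: (@wp_collect1E _ _ _ (in_sch d) _ _ (lookup (meth_rel m))) => //.
  by move=> s1 x r1 r2 s1s s11; rewrite /lookup -guardE /= s11 ?s1s.
move=> a9 b9.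
apply: wp_seq.
apply: (@wp_collect2E _ _ _ (meth_inputs m) _ wdoms _ _ _ picked_input) => //.
  by move=> s1 c x r1 r2 s1s s11 s12; rewrite /picked_input -guardE /= s11 s12.
move=> a10 b10; pose Ds := guessed_domains d w.
apply: wp_seq.
apply: (@wp_collect1E _ _ _ doms _ _ (fun x => Some (enc_bool (x == dhd Ds)))) => //.
  by move=> s1 x r1 r2 s1s s11; rewrite /= s11 s1s.
move=> a11 b11.
apply: wp_seq; apply: (@wp_collect1E _ _ _ wdoms _ _ Some) => //.
  by move=> s1 x r1 r2 s1s s11; rewrite /= s11.
move=> a12 b12.
apply: (@wp_collect1E _ _ _ (collect1 Some wdoms) _ _ (fun x => Some (Cons Nil x))) => //.
  by move=> s1 x r1 r2 s1s s11; rewrite /= s11.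
Qed.

Lemma verdict_congr (P31 P32 P33 P34 P35 P36 P37 V31 V32 V33 V34 V35 V36 V37
    X Y Z W : Prop) :
  (P31 <-> V31) -> (P32 <-> V32) -> (P33 <-> V33) -> (P34 <-> V34) ->
  (P35 <-> V35) -> (P36 <-> V36) -> (P37 <-> V37) ->
  [/\ P31, P32, X, Y & ~ P33] /\ (~ P34 \/ [/\ ~ P35, P36, ~ P37, Z & W]) <->
  [/\ V31, V32, X, Y & ~ V33] /\ (~ V34 \/ [/\ ~ V35, V36, ~ V37, Z & W]).
Proof.
move=> h31 h32 h33 h34 h35 h36 h37.
by split=> -[[]] *; (split; [split; tauto|]);
  match goal with H : _ \/ _ |- _ => case: H => [?|[]] * end;
  [left | right; split | left | right; split]; tauto.
Qed.

Lemma wp_program O d w : wp O program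
  (fun st => accepting st <-> verdict O d (guessed_query d w) (guessed_method d w)
     (guessed_domains d w)) (init d, w).
Proof.
apply: wp_seq.
apply: (wp_weaken _ (wp_program_lists (O := O) (d := d) (w := w))) => -[s w'] /=.
move: (guessed_query d w) (guessed_method d w) (guessed_domains d w) => Q' m Ds.
move=> [[s0 s10 s11 s12 s13] [[s14 s15 s16 s17] [s18 s19 s20 s22]]].
apply: wp_seq; rewrite /program_questions.
apply: wp_seq; apply: wp_ask => b31 h31; apply: wp_seq; apply: wp_ask => b32 h32.
apply: wp_seq; apply: wp_ask => b33 h33; apply: wp_seq; apply: wp_ask => b34 h34.
apply: wp_seq; apply: wp_ask => b35 h35; apply: wp_seq; apply: wp_ask => b36 h36.
apply: wp_ask => b37 h37.
apply: (wp_weaken _ (@wp_program_verdict O _ w' b31 b32 b33 b34 b35 b36 b37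
  erefl erefl erefl erefl erefl erefl erefl)) => -[s'' w''] ->.
rewrite /verdict; cbv zeta.
rewrite -s11 -s12 -s13 -s14 -s15 -s16 -s20 -s22 -s10 -s18 -s19 -s17.
subst d; exact: verdict_congr h31 h32 h33 h34 h35 h36 h37.
Qed.

(** * Correctness on encoded inputs *)

(** For each sequence of guesses a halting run exists by [polytime_program], and [wp_program]
    determines its outcome. *)
Lemma NP_of_verdict (O L : data -> Prop) :
  (forall d, L d <-> exists w, verdict O d (guessed_query d w) (guessed_method d w)
     (guessed_domains d w)) ->
  NP_with_oracle O L.
Proof.
move=> Lw; have [f pf fP] := polytime_program O; have [k fk] := poly_input pf.
have total d w : exists t s w', [/\ run O program (init d, w) t (s, w'),
    t <= f (dsize d) & bounded_store (f (dsize d)) s].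
  apply: fP => x; rewrite /init /upd; case: eqP => //= _; exact: dsize_gt0.
exists program, k => d; split=> [w|].
  have [t [s [w' [r tf _]]]] := total d w.
  by exists t, (s, w'); split=> //; apply: leq_trans tf (fk _).
rewrite Lw; split=> [[w vw]|[w [t [st [r acc]]]]]; last first.
  by exists w; apply/(wp_program r).
have [t [s [w' [r _ _]]]] := total d w.
by exists w, t, (s, w'); split=> //; apply/(wp_program r).
Qed.

(** * Encodings and traversals of encoded lists *)

Lemma enc_seq_inj (T : Type) (enc : T -> data) : injective enc -> injective (enc_seq enc).
Proof. by move=> enc_inj; elim=> [|x s IHs] [|y t] //= [/enc_inj-> /IHs->]. Qed.

Lemma enc_named_inj (T : Type) (enc : T -> data) : injective enc ->
  injective (enc_named enc).
Proof. by move=> enc_inj [S x] [S' y] [/= -> /enc_inj->]. Qed.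

Lemma enc_names_inj : injective enc_names.
Proof. exact: enc_seq_inj. Qed.

Lemma enc_conf_inj : injective enc_conf.
Proof. exact/enc_seq_inj/enc_named_inj/enc_names_inj. Qed.

Lemma enc_schema_inj : injective enc_schema.
Proof. exact: enc_conf_inj. Qed.

Lemma enc_bool_inj : injective enc_bool.
Proof. by move=> [] []. Qed.

Lemma enc_method_inj : injective enc_method.
Proof.
by move=> [R i e] [R' i' e'] [/= -> /(enc_seq_inj enc_bool_inj)-> /enc_bool_inj->].
Qed.

Lemma enc_query_inj : injective enc_query.
Proof.
apply/enc_seq_inj/enc_named_inj/enc_seq_inj => -[x|x] [y|y] //= [-> //].
Qed.

Lemma elems_enc_seq (T : Type) (enc : T -> data) s : elems (enc_seq enc s) = map enc s.
Proof. by elim: s => //= x s ->. Qed.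

Lemma enc_names_map (T : Type) (enc : T -> data) s :
  enc_names (map enc s) = enc_seq enc s.
Proof. by elim: s => //= x s ->. Qed.

Lemma elemsK : cancel elems enc_names.
Proof. by elim=> //= x _ y ->. Qed.

Lemma contained_languageE sch acs conf Q1 Q2 :
  valid_schema sch -> valid_methods sch acs -> over sch (of_facts conf) ->
  valid_query sch conf Q1 -> valid_query sch conf Q2 ->
  containment_language (question (enc_schema sch) (enc_seq enc_method acs)
    (enc_conf conf) (enc_query Q1) (enc_query Q2)) <->
  contained sch acs (of_facts conf) Q1 Q2.
Proof.
move=> us va oC v1 v2; split=> [|c]; last by exists sch, acs, conf, Q1, Q2; split.
move=> [sch' [acs' [conf' [Q1' [Q2' [[]]]]]]].
by move=> /enc_schema_inj-> /(enc_seq_inj enc_method_inj)-> /enc_conf_inj->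
  /enc_query_inj-> /enc_query_inj->.
Qed.

Lemma dhd_enc_names l : dhd (enc_names (rev l)) = last Nil l.
Proof. by case/lastP: l => // l x; rewrite rev_rcons last_rcons. Qed.

(** A traversal may collect the same item several times; the head of its reversed result is still
    that item. *)
Lemma last_constant (T : eqType) (x0 c : T) l :
  l != [::] -> {in l, forall x, x = c} -> last x0 l = c.
Proof. by case: l => //= x l _ lc; apply: lc; rewrite mem_last. Qed.

Lemma enc_names_rev_eq0 l : (enc_names (rev l) == Nil) = (l == [::]).
Proof. by case/lastP: l => // l x; rewrite rev_rcons; case: l. Qed.

Lemma domains_inE sch R doms : valid_schema sch -> (R, doms) \in sch ->
  domains_in (enc_schema sch) R = enc_names doms.
Proof.
move=> us Rd; rewrite /domains_in /collect1 dhd_enc_names elems_enc_seq.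
have mem x : x \in pmap (lookup R) (map (enc_named enc_names) sch) <->
    exists2 ds, (R, ds) \in sch & x = enc_names ds.
  rewrite mem_pmap -map_comp; split=> [/mapP[[S ds] s]|[ds s ->]].
    by rewrite /= /lookup /=; case: eqP => [<-|//] [->]; exists ds.
  by apply/mapP; exists (R, ds); rewrite //= /lookup /= eqxx.
apply: last_constant => [|x /mem[ds s ->]]; last by rewrite (schema_fun us s Rd).
have : enc_names doms \in pmap (lookup R) (map (enc_named enc_names) sch).
  by apply/mem; exists doms.
by case: pmap.
Qed.

Lemma collect1_some (f : data -> data) l :
  collect1 (fun x => Some (f x)) (enc_names l) = enc_names (map f (rev l)).
Proof.
rewrite /collect1 elems_enc_seq map_id map_rev; congr (enc_names (rev _)).
Qed.

Lemma collect1_hits m l : collect1 (hits m) l = Nil <-> m \notin elems l.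
Proof.
split=> [/eqP|]; rewrite /collect1; [|move=> ml; apply/eqP];
  rewrite enc_names_rev_eq0.
  move=> /eqP e; apply/negP => ml.
  have : Nil \in pmap (hits m) (elems l).
    by rewrite mem_pmap; apply/mapP; exists m; rewrite // /hits eqxx.
  by rewrite e.
elim: (elems l) ml => //= x s IHs.
by rewrite inE negb_or /hits eq_sym => /andP[/negbTE-> /IHs].
Qed.

Lemma eq_collected f w w' l l2 : (forall i, i < size l -> w i = w' i) ->
  collected f w l l2 = collected f w' l l2.
Proof.
elim: l w w' l2 => //= x l IHl w w' l2 ww'; rewrite ww' //.
by congr (_ ++ _); apply: IHl => i il; apply: ww'.
Qed.

Lemma mkseq_cons (T : Type) (w : nat -> T) n :
  mkseq w n.+1 = w 0 :: mkseq (fun i => w i.+1) n.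
Proof. by rewrite /mkseq /= (iotaDl 1 0) -map_comp. Qed.

Lemma collected_relabelled d w (Q : query) R l2 : meth_rel (in_meth d) = R ->
  collected (relabelled d) w (map (enc_named (enc_seq enc_term)) Q) l2 =
  map (enc_named (enc_seq enc_term))
    (relabel R (aux_name d 0) (mkseq w (size Q)) Q).
Proof.
move=> eR; elim: Q w l2 => [//|[S ts] Q IHQ] w l2.
rewrite [size _]/= mkseq_cons /relabel /=.
rewrite -[map _ (zip _ _)]/(relabel R _ (mkseq _ _) Q) -(IHQ _ (dtl l2)).
rewrite -cat1s; congr (_ ++ _); rewrite /relabelled cons_eqE enc_bool_eq_tt eR /=.
by case: ifP.
Qed.

Lemma mem_collected_picked w l l2 x : x \in collected picked w l l2 -> x \in l.
Proof.
elim: l w l2 => //= y l IHl w l2; rewrite mem_cat inE /picked guardE.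
by case: (w 0) => /= [|/IHl->]; rewrite ?inE ?orbT // => /orP[->|/IHl->]; rewrite ?orbT.
Qed.

Lemma mem_collected_picked_input w ins ds D : size ins = size ds ->
  D \in collected picked_input w (map enc_bool ins) (enc_names ds) -> D \in mask ins ds.
Proof.
elim: ins ds w => [|i ins IH] [|E ds] w //= [sz]; rewrite mem_cat /picked_input.
rewrite cons_eqE !enc_bool_eq_tt.
case: (w 0); case: i => //=; rewrite ?inE; [move=> /orP[->//|]| | |] => /(IH _ _ sz) //.
all: by move=> ->; rewrite ?orbT.
Qed.

(** Marking every occurrence of [m] is harmless, since only the head of the collected copies is
    used. *)
Lemma collected_pick l2 (m : method) (acs : seq method) :
  collected picked (nth false [seq x == m | x <- acs]) (map enc_method acs) l2 =
  [seq enc_method x | x <- acs & x == m].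
Proof.
elim: acs l2 => //= x acs IH l2; rewrite /picked guardE IH.
by case: eqP.
Qed.

Lemma collected_pick_input ins ds D : size ins = size ds ->
  collected picked_input (nth false [seq E == D | E <- ds]) (map enc_bool ins)
    (enc_names ds) = [seq E <- mask ins ds | E == D].
Proof.
elim: ins ds => [|i ins IH] [|E ds] //= [sz]; rewrite IH //.
rewrite /picked_input cons_eqE !enc_bool_eq_tt.
by case: i; rewrite ?andbT ?andbF //=; case: ifP.
Qed.

(** * The verdict on an encoded input *)

Definition enc_input (sch : schema) (acs : seq method) (conf : seq (name * seq name))
    (a : access) (Q : query) : data :=
  Cons (enc_schema sch) (Cons (enc_seq enc_method acs)
    (Cons (enc_conf conf) (Cons (enc_access a) (enc_query Q)))).

Section Input.
Variables (sch : schema) (acs : seq method) (conf : seq (name * seq name)).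
Variables (a : access) (Q : query) (doms : seq name).
Hypothesis us : valid_schema sch.
Hypothesis va : valid_methods sch acs.
Hypothesis oC : over sch (of_facts conf).
Hypothesis vQ : valid_query sch conf Q.
Hypothesis aa : access_of acs a.
Hypothesis ba : boolean_access a.
Hypothesis Rdoms : (rel (meth a), doms) \in sch.
Let d := enc_input sch acs conf a Q.
Let R := rel (meth a).
Let B := binding a.
Let C := of_facts conf.
Let sB : size B = size doms := size_binding us va aa ba Rdoms.

Lemma aux_names_uniq : uniq [seq aux_name d i | i <- iota 0 5].
Proof. by rewrite /= !inE !cons_eqE /= !andbF. Qed.

(** An auxiliary name contains the whole input [d], so both are larger than every name in the
    schema. *)
Lemma aux_names_fresh S ds : (S, ds) \in sch ->
  S \notin [seq aux_name d i | i <- iota 0 5] /\ d \notin ds.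
Proof.
move=> /dsize_enc_named[szS szd].
have sz : dsize (enc_conf sch) < dsize d.
  by rewrite /d /enc_input -[enc_schema sch]/(enc_conf sch) /=; lia.
split; last by apply/negP => /szd; lia.
apply/mapP => -[i _ eS].
have eN : dsize (aux_name d i) = (dsize d + dsize (num i)).+1 by [].
by move: szS; rewrite eS eN; lia.
Qed.

(** The guess [m] is arbitrary data here. Any data can be read as a list of domains, so the schema
    is legal even if [m] encodes no method. *)
Definition schema_for (m : data) : schema :=
  extended_schema sch a doms (elems (domains_in (enc_schema sch) (meth_rel m)))
    (aux_name d 0) (aux_name d 1) (aux_name d 2) (aux_name d 3) (aux_name d 4) d.

Lemma schema_forE m :
  Cons (Cons (aux_name d 0) (domains_in (in_sch d) (meth_rel (in_meth d))))
 (Cons (Cons (aux_name d 1) (collect1 (fun _ => Some d) (in_binding d)))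
 (Cons (Cons (aux_name d 2)
          (collect1 Some (domains_in (in_sch d) (meth_rel (in_meth d)))))
 (Cons (Cons (aux_name d 3) (domains_in (in_sch d) (meth_rel m)))
 (Cons (Cons (aux_name d 4) Nil) (in_sch d))))) = enc_schema (schema_for m).
Proof.
rewrite (domains_inE us Rdoms : domains_in (in_sch d) (meth_rel (in_meth d)) = _).
rewrite (collect1_some (fun _ => d) B) (collect1_some id doms) map_id.
rewrite /schema_for /extended_schema /enc_schema /= /enc_named /= elemsK.
have const l : [seq d | _ <- l : seq data] = nseq (size l) d by elim: l => //= x l ->.
by rewrite const size_rev.
Qed.

Lemma enc_constants l : collect1 (fun x => Some (Cons tt_data x)) (enc_names l) =
  enc_seq enc_term (map TConst (rev l)).
Proof.
rewrite (collect1_some (Cons tt_data)) -[RHS]enc_names_map -map_comp.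
by congr enc_names; apply: eq_map.
Qed.

Lemma enc_variables l :
  collect1 (fun x => Some (Cons Nil x)) (collect1 Some (enc_names l)) =
  enc_seq enc_term (map TVar l).
Proof.
rewrite (collect1_some id) (collect1_some (Cons Nil)) map_id revK.
by rewrite -[RHS]enc_names_map -map_comp; congr enc_names; apply: eq_map.
Qed.

Lemma valid_schema_for m : valid_schema (schema_for m).
Proof. exact: valid_extended_schema us aux_names_uniq aux_names_fresh. Qed.

Lemma testing_question m (q : pred name) dep :
  ~ containment_language (question (enc_schema (schema_for m))
      (single (Cons (aux_name d 2)
        (Cons (enc_seq enc_bool (map q (rev doms))) (enc_bool dep))))
      (Cons (Cons (aux_name d 1) (in_binding d)) (in_conf d))
      (single (Cons (aux_name d 2)
        (collect1 (fun x => Some (Cons tt_data x)) (in_binding d))))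
      (single (Cons (aux_name d 4) Nil))) <->
  (dep -> forall v D, (v, D) \in zip B doms -> q D -> active_domain sch C v D).
Proof.
rewrite (enc_constants B).
apply: iff_trans (well_formed_question _ us oC Rdoms sB aux_names_uniq
  aux_names_fresh q dep).
apply: not_iff_compat.
apply: (@contained_languageE (schema_for m)
  [:: Method (aux_name d 2) (map q (rev doms)) dep] ((aux_name d 1, B) :: conf)
  [:: (aux_name d 2, map TConst (rev B))] (failing (aux_name d 4))).
- exact: valid_schema_for.
- by apply: valid_methods_testing; rewrite size_map size_rev.
- exact: over_confK oC.
- exact: valid_constants sB.
exact: valid_failing.
Qed.

Lemma well_formed_boolean : well_formed sch C a <->
  (dependent (meth a) -> forall v D, (v, D) \in zip B doms -> true ->
     active_domain sch C v D).
Proof.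
have sz := size_inputs us va aa Rdoms.
split=> [wf dep v D vD _|wf dep ds v D s].
  by apply: wf Rdoms _; rewrite ?mask_all_true.
rewrite (schema_fun us s Rdoms) mask_all_true // => vD.
exact: wf dep _ _ vD isT.
Qed.

(** Every attribute is an input, so the flags of the access method can be reused for the reversed
    columns of [nP]. *)
Lemma inputs_boolean : inputs (meth a) = map predT (rev doms).
Proof.
have all_predT (T : Type) bs (l : seq T) :
    all id bs -> size bs = size l -> bs = map predT l.
  by elim: bs l => [|[] bs IH] [|x l] //= /IH{}IH [/IH<-].
by apply: all_predT => //; rewrite size_rev (size_inputs us va aa Rdoms).
Qed.

(** The question about calling [m] is kept as an oracle question, since [m] need not encode a method
    at this point. *)
Lemma verdictE Q' Q1 bits m Ds : Q' = enc_query Q1 -> size bits = size Q ->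
  Q1 =i relabel R (aux_name d 0) bits Q ->
  verdict containment_language d Q' m Ds <->
  well_formed sch C a /\
  (~ contained (schema_for m) acs (of_facts ((aux_name d 0, B) :: conf)) Q1 Q \/
   [/\ exists2 p, path_on sch acs (full sch) (of_facts ((R, B) :: conf)) p
                & holds Q (final (of_facts ((R, B) :: conf)) p),
       exists2 b, (b, dhd Ds) \in zip B doms & ~ active_domain sch C b (dhd Ds),
       ~ containment_language (question (enc_schema (schema_for m))
            (Cons (Cons (aux_name d 3) (Cons (meth_inputs m) (meth_dep m)))
               (enc_seq enc_method acs))
            (enc_conf ((aux_name d 0, B) :: conf))
            (single (Cons (aux_name d 3)
               (collect1 (fun x => Some (Cons Nil x))
                  (collect1 Some (domains_in (enc_schema sch) (meth_rel m))))))
            (enc_query Q)),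
       meth_dep m <> Nil & Ds <> Nil]).
Proof.
move=> -> sb eQ1; rewrite /verdict; cbv zeta; rewrite schema_forE.
have ma : meth a \in acs by case: aa.
have uf := aux_names_uniq; have fr := aux_names_fresh.
have oR := over_confR oC Rdoms sB.
have vQR : valid_query sch ((R, B) :: conf) Q.
  case: vQ => h1 h2 h3; split=> // S ts c Sts /(h3 _ _ _ Sts)[S' [t [tF ct]]].
  by exists S', t; rewrite inE tF orbT.
have vS := valid_schema_for m.
have vA : valid_methods (schema_for m) acs by apply: valid_methods_extended va.
have vQe f : valid_query (schema_for m) (f :: conf) Q.
  by apply: valid_query_extended.
have h31 : containment_language (question (in_sch d) (in_acs d) (in_conf d)
    (in_query d) (in_query d)).
  by apply/(contained_languageE us va oC vQ vQ) => C' _.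
have h32 : containment_language (question (in_sch d) (in_acs d)
    (Cons (Cons (meth_rel (in_meth d)) (in_binding d)) (in_conf d))
    (in_query d) (in_query d)).
  by apply/(contained_languageE us va oR vQR vQR) => C' _.
have hit : collect1 (hits (in_meth d)) (in_acs d) <> Nil.
  move/collect1_hits; rewrite elems_enc_seq => /negP; apply.
  exact: (map_f enc_method ma).
have bad : collect1 (hits Nil) (meth_inputs (in_meth d)) = Nil.
  apply/collect1_hits; rewrite [meth_inputs _]/(enc_seq enc_bool (inputs (meth a))).
  rewrite elems_enc_seq; apply/mapP => -[b bi eb]; move/allP/(_ _ bi): ba eb.
  by rewrite /= => ->.
have domsE : domains_in (in_sch d) (meth_rel (in_meth d)) = enc_names doms.
  exact: domains_inE.
have h33 := iff_trans (testing_question m predT (dependent (meth a)))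
  (iff_sym well_formed_boolean).
have h34 := @contained_languageE _ _ ((aux_name d 0, B) :: conf) Q1 Q vS vA
  (over_confN _ _ _ _ _ _ oC sB)
  (valid_relabel _ us vQ Rdoms uf fr sb eQ1) (vQe _).
have h35 := @contained_languageE _ _ ((R, B) :: conf) Q (failing (aux_name d 4)) vS vA
  (over_extended _ _ _ _ _ _ _ _ _ oR) (vQe _) (valid_failing _ _ _ _ _ _ _ _ _ _ _).
have r35 := reachable_query Q (elems (domains_in (enc_schema sch) (meth_rel m)))
  va oC Rdoms sB fr.
have h36 := testing_question m (pred1 (dhd Ds)) true.
rewrite -inputs_boolean in h33.
have insE : collect1 (fun x => Some (enc_bool (x == dhd Ds)))
    (domains_in (in_sch d) (meth_rel (in_meth d))) =
    enc_seq enc_bool (map (pred1 (dhd Ds)) (rev doms)).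
  by rewrite domsE (collect1_some (fun x => enc_bool (x == dhd Ds)))
    -[RHS]enc_names_map -map_comp.
rewrite insE.
(* Here the positive answer is the wanted one: some value of [B] at the guessed domain is not
   known. *)
have e36 : containment_language (question (enc_schema (schema_for m))
      (single (Cons (aux_name d 2)
        (Cons (enc_seq enc_bool (map (pred1 (dhd Ds)) (rev doms))) (enc_bool true))))
      (Cons (Cons (aux_name d 1) (in_binding d)) (in_conf d))
      (single (Cons (aux_name d 2)
        (collect1 (fun x => Some (Cons tt_data x)) (in_binding d))))
      (single (Cons (aux_name d 4) Nil))) <->
    exists2 b, (b, dhd Ds) \in zip B doms & ~ active_domain sch C b (dhd Ds).
  split=> [yes|[b bD nb]].
    apply: NNPP => nex; apply: (iffRL h36) yes => _ v D vD /eqP eD.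
    by apply: NNPP => nb; apply: nex; exists v; rewrite -eD.
  apply: NNPP => no; apply: nb; exact: (iffLR h36 no isT _ _ bD (eqxx _)).
split=> [[[_ _ _ _ n33] n34]|[wf n34]].
  split; first exact: (iffLR h33 n33).
  case: n34 => [n34|[n35 y36 n37 dm D0]]; [left|right].
    by move=> c; apply: n34; apply: (iffRL h34 c).
  split=> //; last exact: (iffLR e36 y36).
  by apply: (iffLR r35) => c; apply: n35; apply: (iffRL h35 c).
split; first by split=> //; exact: (iffRL h33 wf).
case: n34 => [n34|[r y36 n37 dm D0]]; [left|right].
  by move=> c; apply: n34; apply: (iffLR h34 c).
split=> //; last exact: (iffRL e36 y36).
by move=> c; apply: (iffRL r35 r); apply: (iffLR h35 c).
Qed.

Lemma guessed_queryE w : guessed_query d w =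
  enc_query (rev (relabel R (aux_name d 0) (mkseq w (size Q)) Q)).
Proof.
rewrite /guessed_query /collect2 elems_enc_seq (@collected_relabelled d _ Q R) //.
by rewrite -map_rev enc_names_map.
Qed.

Lemma call_question m wdoms : m \in acs -> dependent m -> (rel m, wdoms) \in sch ->
  ~ containment_language (question (enc_schema (schema_for (enc_method m)))
      (Cons (Cons (aux_name d 3)
         (Cons (meth_inputs (enc_method m)) (meth_dep (enc_method m))))
         (enc_seq enc_method acs))
      (enc_conf ((aux_name d 0, B) :: conf))
      (single (Cons (aux_name d 3)
         (collect1 (fun x => Some (Cons Nil x))
            (collect1 Some (domains_in (enc_schema sch) (meth_rel (enc_method m)))))))
      (enc_query Q)) <->
  exists p, [/\ path_on sch acs (full sch) (of_facts ((R, B) :: conf)) p,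
    callable_with sch m (final (of_facts ((R, B) :: conf)) p)
    & ~ holds Q (final C p)].
Proof.
move=> ma dm ms; have fr := aux_names_fresh.
have wE : domains_in (enc_schema sch) (meth_rel (enc_method m)) = enc_names wdoms.
  exact: domains_inE.
have sE : schema_for (enc_method m) = extended_schema sch a doms wdoms
    (aux_name d 0) (aux_name d 1) (aux_name d 2) (aux_name d 3) (aux_name d 4) d.
  by rewrite /schema_for wE elems_enc_seq map_id.
rewrite wE enc_variables.
apply: iff_trans (callable_question us va oC vQ Rdoms sB aux_names_uniq
  aux_names_fresh ma dm ms).
rewrite -sE; apply: not_iff_compat.
apply: (@contained_languageE _ (Method (aux_name d 3) (inputs m) (dependent m) :: acs)
  ((aux_name d 0, B) :: conf) [:: (aux_name d 3, map TVar wdoms)] Q).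
- exact: valid_schema_for.
- by rewrite sE; apply: valid_methods_call us va _ ma ms.
- exact: over_confN oC sB.
- by rewrite sE; apply: valid_call us aux_names_uniq aux_names_fresh _.
by apply: valid_query_extended.
Qed.

Lemma verdict_relevant w :
  verdict containment_language d (guessed_query d w) (guessed_method d w)
    (guessed_domains d w) ->
  well_formed sch C a /\ long_term_relevant sch acs C a Q.
Proof.
have sb : size (mkseq w (size Q)) = size Q by rewrite size_mkseq.
move=> /(verdictE _ _ (guessed_queryE w) sb (mem_rev _))[wf].
case=> [nc|[reach [b bD nb] ncall dm D0]]; split=> //.
  apply: (useful_by_path_relevant us va oC aa ba wf Rdoms).
  by apply: relabel_useful us va oC vQ Rdoms sB aux_names_uniq aux_names_fresh _ _ _ _ nc;
    [apply: mem_rev | ].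
(* Had no method been picked, the guess would be [Nil], whose dependence flag is [Nil]. *)
have [m ma em] : exists2 m, m \in acs & guessed_method d w = enc_method m.
  move: dm; rewrite /guessed_method /collect2 dhd_enc_names !elems_enc_seq.
  set l := collected _ _ _ _; have lP x : x \in l -> x \in map enc_method acs.
    exact: mem_collected_picked.
  case: l lP => //= x l lP _.
  by have /lP/mapP[m ma ->] := mem_last x l; exists m.
have dep : dependent m.
  by move: dm; rewrite em /meth_dep /=; case: (dependent m).
have [wdoms ms sz] := va ma.
have Dm : dhd (guessed_domains d w) \in mask (inputs m) wdoms.
  move: D0; rewrite /guessed_domains em /=.
  rewrite (domains_inE us ms : domains_in (in_sch d) (meth_rel (enc_method m)) = _).
  rewrite /collect2 dhd_enc_names !elems_enc_seq.
  set l := collected _ _ _ _; have lP x : x \in l -> x \in mask (inputs m) wdoms.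
    exact: mem_collected_picked_input.
  by case: l lP => //= x l lP _; apply/lP/mem_last.
have [p [pp cm nQ]] : exists p,
    [/\ path_on sch acs (full sch) (of_facts ((R, B) :: conf)) p,
    callable_with sch m (final (of_facts ((R, B) :: conf)) p) & ~ holds Q (final C p)].
  by apply/(call_question ma dep ms); rewrite -em.
apply: (useful_by_truncation_relevant us va oC aa ba wf Rdoms) => //.
  by case: vQ.
split=> //; exists m, (dhd (guessed_domains d w)), p; split=> //.
by split=> //; [exists wdoms | exists b].
Qed.

Lemma relevant_verdict : well_formed sch C a -> long_term_relevant sch acs C a Q ->
  exists w, verdict containment_language d (guessed_query d w) (guessed_method d w)
    (guessed_domains d w).
Proof.
move=> wf /(relevant_useful us va oC aa ba Rdoms)[up|[reach [m [D [p]]]]].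
  have [bits sb nc] := useful_relabel (elems (domains_in (enc_schema sch)
    (meth_rel (guessed_method d (fun=> false))))) us va oC vQ Rdoms sB
    aux_names_uniq aux_names_fresh up.
  (* Only the relabelling is guessed; all later guesses are the default [false]. *)
  exists (nth false bits).
  have sbm : size (mkseq (nth false bits) (size Q)) = size Q by rewrite size_mkseq.
  apply/(verdictE _ _ (guessed_queryE _) sbm (mem_rev _)); split=> //; left.
  (* The method is guessed beyond the end of [bits], so the schema is the one for which [nc] was
     obtained. *)
  have -> : guessed_method d (nth false bits) = guessed_method d (fun=> false).
    rewrite /guessed_method /collect2 !elems_enc_seq size_map /shift_by.
    congr (dhd (enc_names (rev _))); apply: eq_collected => i _.
    by rewrite nth_default // sb leq_addr.
  by apply: nc => x; rewrite mem_rev -{1}sb mkseq_nth.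
move=> [[ma dm [wdoms ms Dm] [b bD nb]] pp cm nQ].
(* Relabel no atom, then mark the method [m], then mark the domain [D] among its attributes. *)
pose bits := nseq (size Q) false ++ [seq x == m | x <- acs] ++ [seq E == D | E <- wdoms].
have sz := method_domains va us ma ms.
pose w := nth false bits; exists w.
have wQ i : w (size Q + i) =
    nth false ([seq x == m | x <- acs] ++ [seq E == D | E <- wdoms]) i.
  by rewrite /w /bits nth_cat size_nseq ltnNge leq_addr /= addKn.
have last_pred (T : eqType) (x0 x : T) (s : seq T) : x \in s ->
    last x0 [seq y <- s | y == x] = x.
  move=> xs; apply: last_constant; last by move=> y; rewrite mem_filter => /andP[/eqP].
  by rewrite -has_filter; apply/hasP; exists x.
have em : guessed_method d w = enc_method m.
  rewrite /guessed_method /collect2 dhd_enc_names !elems_enc_seq size_map.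
  rewrite (@eq_collected _ _ (nth false [seq x == m | x <- acs])) => [|i].
    rewrite collected_pick; case e: [seq x <- acs | x == m] => [|y s].
      by have := mem_filter (pred1 m) m acs; rewrite e /= eqxx ma.
    by rewrite /= last_map -[m in RHS](last_pred _ y _ _ ma) e.
  rewrite size_map /shift_by wQ => il.
  by rewrite nth_cat size_map il.
have eD : guessed_domains d w = enc_names (rev [seq E <- mask (inputs m) wdoms | E == D]).
  rewrite /guessed_domains em.
  rewrite (domains_inE us ms : domains_in (in_sch d) (meth_rel (enc_method m)) = _).
  rewrite /collect2 !elems_enc_seq !size_map -(collected_pick_input D sz).
  congr (enc_names (rev _)); apply: eq_collected => i il.
  by rewrite /shift_by wQ nth_cat size_map ltnNge leq_addr /= addKn.
have lD : dhd (guessed_domains d w) = D.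
  by rewrite eD dhd_enc_names last_pred.
have sbm : size (mkseq w (size Q)) = size Q by rewrite size_mkseq.
apply/(verdictE _ _ (guessed_queryE _) sbm (mem_rev _)); split=> //; right.
rewrite lD em; split=> //.
- by exists b.
- by apply/(call_question ma dm ms); exists p.
- by rewrite /meth_dep /= dm.
rewrite eD => /eqP; rewrite enc_names_rev_eq0 => /eqP e.
by have := mem_filter (pred1 D) D (mask (inputs m) wdoms); rewrite e /= eqxx Dm.
Qed.
End Input.

(** Positive oracle answers certify legality. The first question covers the schema, methods,
    configuration and query; the second, with the fact of the access in the configuration, also
    gives the arity of the binding. *)
Lemma accepted_input d w :
  verdict containment_language d (guessed_query d w) (guessed_method d w)
    (guessed_domains d w) ->
  exists sch acs conf a Q doms,
    [/\ d = enc_input sch acs conf a Q,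
        [/\ valid_schema sch, valid_methods sch acs,
            over sch (of_facts conf) & valid_query sch conf Q],
        access_of acs a, boolean_access a & (rel (meth a), doms) \in sch].
Proof.
move=> [[o1 o2 hit bad _] _].
have [sch [acs [conf [Q [Q2 [[eS eA eC eQ _] [us va oC vQ _] _]]]]]] := o1.
have [sch' [acs' [conf' [Q' [Q2' [[eS' _ eC' _ _] [_ _ oC' _ _] _]]]]]] := o2.
have [m ma em] : exists2 m, m \in acs & in_meth d = enc_method m.
  have : in_meth d \in elems (in_acs d).
    by apply/negPn/negP => /collect1_hits.
  by rewrite eA elems_enc_seq => /mapP.
pose a := Access m (elems (in_binding d)).
have eC1 : conf' = (rel m, binding a) :: conf.
  by apply: enc_conf_inj; rewrite -eC' eC em /= /enc_named /= elemsK.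
have [doms Rd sB] : exists2 doms, (rel m, doms) \in sch & size (binding a) = size doms.
  rewrite -(enc_schema_inj (etrans (esym eS') eS)).
  by apply: oC'; rewrite eC1 /of_facts mem_head.
have ba : boolean_access a.
  move/collect1_hits: bad; rewrite em [meth_inputs _]/(enc_seq enc_bool (inputs m)).
  rewrite elems_enc_seq => nbad; apply/allP => -[//|] bi.
  by case/mapP: nbad; exists false.
exists sch, acs, conf, a, Q, doms; split=> //.
  rewrite /enc_input -eS -eA -eC -eQ /enc_access -em /= elemsK.
  move: em; rewrite /in_meth /in_acc /in_sch /in_acs /in_conf /in_binding /in_query.
  (* The encoding of a method is not [Nil], which forces [d] to have the shape of an input. *)
  by case: (d) => [|? [|? [|? [|[|? ?] ?]]]].
split=> //; rewrite sB -(method_domains va us ma Rd).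
by apply/esym/eqP; rewrite -all_count.
Qed.

Theorem proposition3p5 :
  NP_with_oracle containment_language boolean_ltr_language.
Proof.
apply: NP_of_verdict => d; split.
  move=> [sch [acs [conf [a [Q [-> [us va oC vQ] [aa ba wf] ltr]]]]]].
  have [doms Rd _] := va _ (proj1 aa).
  exact: relevant_verdict us va oC vQ aa ba Rd wf ltr.
move=> [w vw]; have [sch [acs [conf [a [Q [doms [ed [us va oC vQ] aa ba Rd]]]]]]] :=
  accepted_input vw.
rewrite ed in vw *; have [wf ltr] := verdict_relevant us va oC vQ aa ba Rd vw.
by exists sch, acs, conf, a, Q.
Qed.
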